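(* Let $E$ be an arbitrary directed graph and let $K$ be any field. Then the Leavitt path algebra $L_K(E)$ is of finite irreducible representation type if and only if all of the following conditions hold: (i) $E$ is acyclic; (ii) $E^0$ has only finitely many distinct hereditary saturated subsets $H$, and for each such $H$ the corresponding set $B_H$ of breaking vertices is finite; and (iii) in the poset of admissible pairs in $E$, $(E^0,\emptyset)$ is the supremum of a finite ascending chain $$(H_0=\emptyset,\emptyset)\le(H_1,\emptyset)\le(H_1,B_{H_1})\le(H_2,B_{H_1}\cap B_{H_2})\le(H_2,B_{H_2})\le(H_3,B_{H_2}\cap B_{H_3})\le(H_3,B_{H_3})\le\cdots$$ where, for each $j\ge 0$, $H_{j+1}$ is a hereditary saturated subset of $E^0$ and $H_{j+1}\setminus H_j$ is the hereditary saturated closure (in the graph $E\setminus(H_j,B_{H_j})$) of the set of line points in $E\setminus(H_j,B_{H_j})$.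
   Context: A directed graph $E=(E^0,E^1,r,s)$ consists of a set $E^0$ of vertices, a set $E^1$ of edges and maps $r,s:E^1\to E^0$ (range and source); there are no restrictions on the cardinalities of $E^0$, $E^1$ or of the sets $s^{-1}(v)$. A vertex $v$ is regular if $0<|s^{-1}(v)|<\infty$, and an infinite emitter if $s^{-1}(v)$ is infinite. Given a field $K$, the Leavitt path algebra $L_K(E)$ is the (not necessarily unital) $K$-algebra generated by pairwise orthogonal idempotents $\{v:v\in E^0\}$ and elements $\{e,e^*:e\in E^1\}$ subject to: (1) $s(e)e=e=er(e)$; (2) $r(e)e^*=e^*=e^*s(e)$; (3) $e^*e=r(e)$ and $e^*f=0$ for edges $e\ne f$; (4) $v=\sum_{e\in E^1,\,s(e)=v}ee^*$ for every regular vertex $v$. $L_K(E)$ is of finite irreducible representation type if it has at most finitely many distinct isomorphism classes of simple left $L_K(E)$-modules. A left module $S$ over a ring $R$ (not necessarily unital) is simple if $RS\neq 0$ and $S$ has no submodules other than $0$ and $S$. A path $e_1\cdots e_n$ ($n\ge1$, $r(e_i)=s(e_{i+1})$) is closed if $r(e_n)=s(e_1)$ (then it is based at $s(e_1)$); a closed path is a cycle if $s(e_i)\ne s(e_j)$ for $i\ne j$; $E$ is acyclic if it has no cycles. Write $u\ge v$ if there is a path (possibly of length $0$) from $u$ to $v$, and $T(v)=\{w: v\ge w\}$. A vertex $v$ is a line point if no vertex in $T(v)$ emits more than one edge or is the base of a cycle. A subset $H\subseteq E^0$ is hereditary if $v\in H$ and $v\ge w$ imply $w\in H$; a hereditary set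 $H$ is saturated if for every regular vertex $v$, $r(s^{-1}(v))\subseteq H$ implies $v\in H$. The hereditary saturated closure of a set of vertices of a graph is the smallest hereditary saturated subset of that graph containing it. A breaking vertex of a hereditary saturated set $H$ is an infinite emitter $w\in E^0\setminus H$ with $1\le|s^{-1}(w)\cap r^{-1}(E^0\setminus H)|<\infty$; $B_H$ is the set of all breaking vertices of $H$. An admissible pair is a pair $(H,S)$ with $H$ hereditary saturated and $S\subseteq B_H$; admissible pairs are partially ordered by $(H,S)\le(H',S')$ iff $H\subseteq H'$ and $S\subseteq H'\cup S'$. The graph $E\setminus(H,B_H)$ has vertex set $E^0\setminus H$ and edge set $\{e\in E^1: r(e)\notin H\}$, with the restricted maps $r,s$. *)

(* Defs.v *)
From HB Require Import structures.
From mathcomp Require Import all_boot all_order all_algebra.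
From mathcomp Require Import finmap boolp classical_sets functions cardinality.

Set Implicit Arguments.
Unset Strict Implicit.
Unset Printing Implicit Defensive.

Import Order.TTheory GRing.Theory.
Local Open Scope classical_set_scope.
Local Open Scope ring_scope.
Local Open Scope quotient_scope.

(* MathComp rings are unital, hence the following three structures. *)

HB.mixin Record Zmodule_isNonUnitalRing R of GRing.Zmodule R := {
  numul : R -> R -> R;
  numulA : associative numul;
  numulDl : left_distributive numul +%R;
  numulDr : right_distributive numul +%R
}.

#[short(type="nonUnitalRingType")]
HB.structure Definition NonUnitalRing :=
  {R of Zmodule_isNonUnitalRing R & GRing.Zmodule R}.

HB.mixin Record isNonUnitalAlgebra (K : comNzRingType) A
    of NonUnitalRing A & GRing.Lmodule K A := {
  nuscalerAl : forall (k : K) (a b : A), k *: numul a b = numul (k *: a) b;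
  nuscalerAr : forall (k : K) (a b : A), k *: numul a b = numul a (k *: b)
}.

#[short(type="nonUnitalAlgType")]
HB.structure Definition NonUnitalAlgebra (K : comNzRingType) :=
  {A of isNonUnitalAlgebra K A & NonUnitalRing A & GRing.Lmodule K A}.

HB.mixin Record Zmodule_isNonUnitalLmodule (R : nonUnitalRingType) M
    of GRing.Zmodule M := {
  nuact : R -> M -> M;
  nuactA : forall a b m, nuact a (nuact b m) = nuact (numul a b) m;
  nuactDl : forall a b m, nuact (a + b) m = nuact a m + nuact b m;
  nuactDr : forall a m n, nuact a (m + n) = nuact a m + nuact a n
}.

#[short(type="nonUnitalLmodType")]
HB.structure Definition NonUnitalLmodule (R : nonUnitalRingType) :=
  {M of Zmodule_isNonUnitalLmodule R M & GRing.Zmodule M}.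

Definition submodule (R : nonUnitalRingType) (M : nonUnitalLmodType R)
    (N : set M) :=
  [/\ N 0,
      forall x y, N x -> N y -> N (x - y) &
      forall (a : R) x, N x -> N (nuact a x)].

(* R M is the additive subgroup generated by the products a m, so that it is
   nonzero exactly when one of these products is. *)
Definition simple_module (R : nonUnitalRingType) (M : nonUnitalLmodType R) :=
  (exists (a : R) (m : M), nuact a m <> 0) /\
  (forall N : set M, submodule N -> N = [set 0] \/ N = setT).

Definition module_iso (R : nonUnitalRingType) (M N : nonUnitalLmodType R) :=
  exists f : {additive M -> N},
    bijective f /\ (forall (a : R) m, f (nuact a m) = nuact a (f m)).

Definition finite_irreducible_representation_type (R : nonUnitalRingType) :=
  exists (n : nat) (S : 'I_n -> nonUnitalLmodType R),
    (forall i, simple_module (S i)) /\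
    (forall M : nonUnitalLmodType R,
       simple_module M -> exists i, module_iso M (S i)).

Record digraph := Digraph {
  vertex : Type;
  edge : Type;
  rng : edge -> vertex;
  src : edge -> vertex
}.

(* Decidable equality and choice come from classical logic: they restrict
   neither the vertices nor the edges. *)
HB.instance Definition _ (E : digraph) := gen_eqMixin (vertex E).
HB.instance Definition _ (E : digraph) := gen_choiceMixin (vertex E).
HB.instance Definition _ (E : digraph) := gen_eqMixin (edge E).
HB.instance Definition _ (E : digraph) := gen_choiceMixin (edge E).

Section Digraph.
Variable E : digraph.
Implicit Types (u v w : vertex E) (e : edge E) (p : seq (edge E)).
Implicit Types (H X : set (vertex E)).

Definition out_edges v : set (edge E) := [set e | src e = v].

Definition regular v := finite_set (out_edges v) /\ out_edges v !=set0.

Definition infinite_emitter v := ~ finite_set (out_edges v).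

(* The nonempty path e_1 ... e_n is represented by e_1 and [:: e_2; ...; e_n]. *)
Definition is_path e p := path (fun f g => rng f == src g) e p.

Definition is_closed_path e p := is_path e p /\ rng (last e p) = src e.

Definition is_cycle e p :=
  is_closed_path e p /\ uniq [seq src f | f <- e :: p].

Definition acyclic := forall e p, ~ is_cycle e p.

Definition reaches u v :=
  u = v \/ exists e p, [/\ is_path e p, src e = u & rng (last e p) = v].

Definition tree v : set (vertex E) := [set w | reaches v w].

Definition line_point v := forall w, tree v w ->
  (forall e f, src e = w -> src f = w -> e = f) /\
  (forall e p, is_cycle e p -> src e <> w).

Definition line_points : set (vertex E) := [set v | line_point v].

Definition hereditary H := forall v w, H v -> reaches v w -> H w.

Definition saturated H :=
  forall v, regular v -> @rng E @` out_edges v `<=` H -> H v.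

Definition hs_closure X : set (vertex E) :=
  smallest (fun H => hereditary H /\ saturated H) X.

Definition breaking H : set (vertex E) :=
  [set w | [/\ infinite_emitter w, ~ H w,
      out_edges w `&` @rng E @^-1` (~` H) !=set0 &
      finite_set (out_edges w `&` @rng E @^-1` (~` H))]].

Record hersat := HerSat {
  hersat_set :> set (vertex E);
  hersat_hereditary : hereditary hersat_set;
  hersat_saturated : saturated hersat_set
}.

Lemma hereditary0 : hereditary set0. Proof. by []. Qed.

Lemma saturated0 : saturated set0.
Proof. by move=> v [_ [e ev]] /(_ (rng e)); apply; exists e. Qed.

Definition hersat0 := HerSat hereditary0 saturated0.

Lemma hereditaryT : hereditary setT. Proof. by []. Qed.

Lemma saturatedT : saturated setT. Proof. by []. Qed.

Definition hersatT := HerSat hereditaryT saturatedT.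

Record admissible_pair := AdmissiblePair {
  adm_hersat : hersat;
  adm_breaking : set (vertex E);
  adm_breakingP : adm_breaking `<=` breaking adm_hersat
}.

HB.instance Definition _ := gen_eqMixin admissible_pair.
HB.instance Definition _ := gen_choiceMixin admissible_pair.

Implicit Types P Q : admissible_pair.

Definition adm_le P Q :=
  adm_hersat P `<=` adm_hersat Q /\
  adm_breaking P `<=` adm_hersat Q `|` adm_breaking Q.

Lemma adm_le_refl : reflexive (fun P Q => `[< adm_le P Q >]).
Proof. by move=> P; apply/asboolP; split=> // v Pv; right. Qed.

Lemma adm_le_anti : antisymmetric (fun P Q => `[< adm_le P Q >]).
Proof.
move=> [[H hH sH] S SB] [[H' hH' sH'] S' SB'].
case/andP=> /asboolP[/= HH' SS'] /asboolP[/= H'H S'S].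
have eqH : H = H' by apply/seteqP.
rewrite {H'H HH'}eqH in hH sH SB SS' S'S *.
have eqS : S = S'.
  apply/seteqP; split=> v Sv.
    by case: (SS' v Sv) => // Hv; case: (SB v Sv).
  by case: (S'S v Sv) => // Hv; case: (SB' v Sv).
rewrite {}eqS in SB *.
have eqh := Prop_irrelevance hH hH'; rewrite {}eqh in SB *.
have eqs := Prop_irrelevance sH sH'; rewrite {}eqs in SB *.
by rewrite (Prop_irrelevance SB SB').
Qed.

Lemma adm_le_trans : transitive (fun P Q => `[< adm_le P Q >]).
Proof.
move=> Q P T /asboolP[PQ PQs] /asboolP[QT QTs]; apply/asboolP; split.
  exact: subset_trans QT.
by move=> v /PQs[/QT|/QTs//]; left.
Qed.

HB.instance Definition _ := Order.Le_isPOrder.Build (Order.Disp tt tt)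
  admissible_pair adm_le_refl adm_le_anti adm_le_trans.

Definition adm0 (H : hersat) : admissible_pair :=
  @AdmissiblePair H set0 (@sub0set _ _).

Definition admB (H : hersat) : admissible_pair :=
  @AdmissiblePair H (breaking H) (@subset_refl _ _).

Definition admI (H H' : hersat) : admissible_pair :=
  @AdmissiblePair H' (breaking H `&` breaking H') (@subIsetr _ _ _).

(* The sequence (H_0, set0), (H_1, set0), (H_1, B_{H_1}),
   (H_2, B_{H_1} `&` B_{H_2}), (H_2, B_{H_2}), ... *)
Definition adm_chain (H : nat -> hersat) (k : nat) : admissible_pair :=
  if k is k'.+2 then
    if odd k then admI (H k./2) (H k./2.+1) else admB (H k./2)
  else adm0 (H k).

End Digraph.

Arguments line_points : clear implicits.

Lemma src_notin (E : digraph) (H : hersat E) (e : edge E) :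
  ~ hersat_set H (rng e) -> ~ hersat_set H (src e).
Proof.
move=> He Hs; apply/He/(hersat_hereditary Hs); right.
by exists e, [::].
Qed.

(* E \ (H, B_H): keeping all of B_H adds no vertex or edge to E \ H, so only H
   occurs below. *)
Definition quotient_graph (E : digraph) (H : hersat E) : digraph :=
  @Digraph {v : vertex E | ~ hersat_set H v}
    {e : edge E | ~ hersat_set H (rng e)}
    (fun e => exist _ (rng (sval e)) (svalP e))
    (fun e => exist _ (src (sval e)) (src_notin (svalP e))).

(* L_K(E): formal (nonunital) K-algebra expressions in the generators, modulo
   the congruence generated by the algebra axioms and the defining relations. *)
Section LeavittPathAlgebra.
Variables (K : fieldType) (E : digraph).

Inductive lpa_term : Type :=
| TVertex of vertex E
| TEdge of edge E
| TGhost of edge E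
| TZero
| TOpp of lpa_term
| TAdd of lpa_term & lpa_term
| TScale of K & lpa_term
| TMul of lpa_term & lpa_term.

HB.instance Definition _ := gen_eqMixin lpa_term.
HB.instance Definition _ := gen_choiceMixin lpa_term.

Inductive lpa_eq : lpa_term -> lpa_term -> Prop :=
| lpa_refl x : lpa_eq x x
| lpa_sym x y : lpa_eq x y -> lpa_eq y x
| lpa_trans x y z : lpa_eq x y -> lpa_eq y z -> lpa_eq x z
| lpa_congN x y : lpa_eq x y -> lpa_eq (TOpp x) (TOpp y)
| lpa_congD x x' y y' :
    lpa_eq x x' -> lpa_eq y y' -> lpa_eq (TAdd x y) (TAdd x' y')
| lpa_congZ k x y : lpa_eq x y -> lpa_eq (TScale k x) (TScale k y)
| lpa_congM x x' y y' :
    lpa_eq x x' -> lpa_eq y y' -> lpa_eq (TMul x y) (TMul x' y')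
| lpa_addA x y z : lpa_eq (TAdd x (TAdd y z)) (TAdd (TAdd x y) z)
| lpa_addC x y : lpa_eq (TAdd x y) (TAdd y x)
| lpa_add0 x : lpa_eq (TAdd TZero x) x
| lpa_addN x : lpa_eq (TAdd (TOpp x) x) TZero
| lpa_scaleA k l x : lpa_eq (TScale k (TScale l x)) (TScale (k * l) x)
| lpa_scale1 x : lpa_eq (TScale 1 x) x
| lpa_scaleDr k x y :
    lpa_eq (TScale k (TAdd x y)) (TAdd (TScale k x) (TScale k y))
| lpa_scaleDl k l x :
    lpa_eq (TScale (k + l) x) (TAdd (TScale k x) (TScale l x))
| lpa_mulA x y z : lpa_eq (TMul x (TMul y z)) (TMul (TMul x y) z)
| lpa_mulDl x y z : lpa_eq (TMul (TAdd x y) z) (TAdd (TMul x z) (TMul y z))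
| lpa_mulDr x y z : lpa_eq (TMul x (TAdd y z)) (TAdd (TMul x y) (TMul x z))
| lpa_scaleAl k x y : lpa_eq (TScale k (TMul x y)) (TMul (TScale k x) y)
| lpa_scaleAr k x y : lpa_eq (TScale k (TMul x y)) (TMul x (TScale k y))
| lpa_vertex_idem v : lpa_eq (TMul (TVertex v) (TVertex v)) (TVertex v)
| lpa_vertex_orth v w : v <> w -> lpa_eq (TMul (TVertex v) (TVertex w)) TZero
| lpa_src_edge e : lpa_eq (TMul (TVertex (src e)) (TEdge e)) (TEdge e)
| lpa_edge_rng e : lpa_eq (TMul (TEdge e) (TVertex (rng e))) (TEdge e)
| lpa_rng_ghost e : lpa_eq (TMul (TVertex (rng e)) (TGhost e)) (TGhost e)
| lpa_ghost_src e : lpa_eq (TMul (TGhost e) (TVertex (src e))) (TGhost e)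
| lpa_ghost_edge e : lpa_eq (TMul (TGhost e) (TEdge e)) (TVertex (rng e))
| lpa_ghost_edge_neq e f : e <> f -> lpa_eq (TMul (TGhost e) (TEdge f)) TZero
| lpa_regular v : regular v ->
    lpa_eq (TVertex v)
      (\big[TAdd/TZero]_(e <- fset_set (out_edges v)) TMul (TEdge e) (TGhost e)).

Definition lpa_eqb (x y : lpa_term) : bool := `[< lpa_eq x y >].

Lemma lpa_eqb_refl : reflexive lpa_eqb.
Proof. by move=> x; apply/asboolP/lpa_refl. Qed.

Lemma lpa_eqb_sym : symmetric lpa_eqb.
Proof. by move=> x y; apply: asbool_equiv_eq; split; exact: lpa_sym. Qed.

Lemma lpa_eqb_trans : transitive lpa_eqb.
Proof.
by move=> y x z /asboolP xy /asboolP yz; apply/asboolP/(lpa_trans xy yz).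
Qed.

Canonical lpa_equiv := EquivRel lpa_eqb lpa_eqb_refl lpa_eqb_sym lpa_eqb_trans.

Definition leavitt_path_algebra := {eq_quot lpa_equiv}.
Local Notation L := leavitt_path_algebra.

HB.instance Definition _ := Choice.on L.
HB.instance Definition _ := EqQuotient.on L.

Lemma lpa_piP x y : lpa_eq x y <-> \pi_L x = \pi_L y.
Proof.
by split=> [xy|/eqmodP/asboolP//]; apply/eqmodP/asboolP.
Qed.

Lemma lpa_reprK x : lpa_eq (repr (\pi_L x)) x.
Proof. by apply/lpa_piP; rewrite reprK. Qed.

Definition lpa_zero : L := \pi_L TZero.
Definition lpa_opp (a : L) : L := \pi_L (TOpp (repr a)).
Definition lpa_add (a b : L) : L := \pi_L (TAdd (repr a) (repr b)).
Definition lpa_scale (k : K) (a : L) : L := \pi_L (TScale k (repr a)).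
Definition lpa_mul (a b : L) : L := \pi_L (TMul (repr a) (repr b)).

Lemma lpa_piN x : lpa_opp (\pi_L x) = \pi_L (TOpp x).
Proof. exact/lpa_piP/lpa_congN/lpa_reprK. Qed.

Lemma lpa_piD x y : lpa_add (\pi_L x) (\pi_L y) = \pi_L (TAdd x y).
Proof. by apply/lpa_piP/lpa_congD; exact: lpa_reprK. Qed.

Lemma lpa_piZ k x : lpa_scale k (\pi_L x) = \pi_L (TScale k x).
Proof. exact/lpa_piP/lpa_congZ/lpa_reprK. Qed.

Lemma lpa_piM x y : lpa_mul (\pi_L x) (\pi_L y) = \pi_L (TMul x y).
Proof. by apply/lpa_piP/lpa_congM; exact: lpa_reprK. Qed.

Let lpa_pi := (lpa_piN, lpa_piD, lpa_piZ, lpa_piM).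

Lemma lpa_ind (P : L -> Prop) : (forall x, P (\pi_L x)) -> forall a, P a.
Proof. by move=> Ppi a; rewrite -[a]reprK. Qed.

Fact lpa_addrA : associative lpa_add.
Proof.
elim/lpa_ind=> x; elim/lpa_ind=> y; elim/lpa_ind=> z.
by rewrite !lpa_pi; apply/lpa_piP/lpa_addA.
Qed.

Fact lpa_addrC : commutative lpa_add.
Proof.
by elim/lpa_ind=> x; elim/lpa_ind=> y; rewrite !lpa_pi; apply/lpa_piP/lpa_addC.
Qed.

Fact lpa_add0r : left_id lpa_zero lpa_add.
Proof. by elim/lpa_ind=> x; rewrite !lpa_pi; apply/lpa_piP/lpa_add0. Qed.

Fact lpa_addNr : left_inverse lpa_zero lpa_opp lpa_add.
Proof. by elim/lpa_ind=> x; rewrite !lpa_pi; apply/lpa_piP/lpa_addN. Qed.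

HB.instance Definition _ :=
  GRing.isZmodule.Build L lpa_addrA lpa_addrC lpa_add0r lpa_addNr.

Fact lpa_mulrA : associative lpa_mul.
Proof.
elim/lpa_ind=> x; elim/lpa_ind=> y; elim/lpa_ind=> z.
by rewrite !lpa_pi; apply/lpa_piP/lpa_mulA.
Qed.

Fact lpa_mulrDl : left_distributive lpa_mul lpa_add.
Proof.
elim/lpa_ind=> x; elim/lpa_ind=> y; elim/lpa_ind=> z.
by rewrite !lpa_pi; apply/lpa_piP/lpa_mulDl.
Qed.

Fact lpa_mulrDr : right_distributive lpa_mul lpa_add.
Proof.
elim/lpa_ind=> x; elim/lpa_ind=> y; elim/lpa_ind=> z.
by rewrite !lpa_pi; apply/lpa_piP/lpa_mulDr.
Qed.

HB.instance Definition _ :=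
  Zmodule_isNonUnitalRing.Build L lpa_mulrA lpa_mulrDl lpa_mulrDr.

Fact lpa_scalerA k l a : lpa_scale k (lpa_scale l a) = lpa_scale (k * l) a.
Proof. by elim/lpa_ind: a => x; rewrite !lpa_pi; apply/lpa_piP/lpa_scaleA. Qed.

Fact lpa_scale1r : left_id 1 lpa_scale.
Proof. by elim/lpa_ind=> x; rewrite !lpa_pi; apply/lpa_piP/lpa_scale1. Qed.

Fact lpa_scalerDr : right_distributive lpa_scale lpa_add.
Proof.
move=> k; elim/lpa_ind=> x; elim/lpa_ind=> y.
by rewrite !lpa_pi; apply/lpa_piP/lpa_scaleDr.
Qed.

Fact lpa_scalerDl a : {morph lpa_scale^~ a : k l / k + l >-> lpa_add k l}.
Proof.
by elim/lpa_ind: a => x k l; rewrite !lpa_pi; apply/lpa_piP/lpa_scaleDl.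
Qed.

HB.instance Definition _ := GRing.Zmodule_isLmodule.Build K L
  lpa_scalerA lpa_scale1r lpa_scalerDr lpa_scalerDl.

Fact lpa_scalerAl k (a b : L) : k *: numul a b = numul (k *: a) b.
Proof.
elim/lpa_ind: a => x; elim/lpa_ind: b => y.
by rewrite /GRing.scale /numul /= !lpa_pi; apply/lpa_piP/lpa_scaleAl.
Qed.

Fact lpa_scalerAr k (a b : L) : k *: numul a b = numul a (k *: b).
Proof.
elim/lpa_ind: a => x; elim/lpa_ind: b => y.
by rewrite /GRing.scale /numul /= !lpa_pi; apply/lpa_piP/lpa_scaleAr.
Qed.

HB.instance Definition _ :=
  isNonUnitalAlgebra.Build K L lpa_scalerAl lpa_scalerAr.

End LeavittPathAlgebra.

(* Main.v *)
Require Import Defs.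
From HB Require Import structures.
From mathcomp Require Import all_boot all_order all_algebra.
From mathcomp Require Import finmap boolp classical_sets functions cardinality.
From mathcomp Require Import zify.

(** Simple modules are obtained from the action of L_K(E) on K-valued functions
on boundary paths, as simple quotients of cyclic submodules.

If c is a cycle then, for every prime p, some simple module contains a nonzero
vector m fixed by all c^n (c^n)^* with (1 + c + ... + c^(p-1)) m = 0.  In that
module every other vector fixed by all c^n (c^n)^* lies in K[c] m, so that
distinct primes need distinct modules.  A hereditary saturated set H is
recovered from the simple modules that it annihilates.  For w in B_H the
projection w - sum_(r(e) notin H) e e^* is nonzero on some simple module
annihilated by H, and projections of distinct w generate orthogonal ideals
modulo H.  Finally, if E \ H is nonempty without line points, then every vertex
leads to a bifurcation, so some infinite path leaves each of finitely many
given infinite paths infinitely often; but two infinite paths realized in the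
same simple module eventually coincide.

Conversely, given the chain, let S be simple and j maximal with H_j S = 0.
Either the projection of some w in B_{H_j} is nonzero on S, or the vertices
annihilating S form a saturated set in E \ H_j as well, so that u S <> 0 for some
line point u of E \ H_j.  In both cases the corner of L_K(E) at this projection
acts by scalars that do not depend on S, which determines S up to isomorphism.
Thus S is determined by j, {v | v S = 0} and possibly w. *)

Set Implicit Arguments.
Unset Strict Implicit.
Unset Printing Implicit Defensive.

Import Order.TTheory GRing.Theory.
Local Open Scope classical_set_scope.
Local Open Scope ring_scope.
Local Open Scope quotient_scope.

Lemma finite_set_of_relation (I : finType) (T : choiceType) (A : set T)
    (r : I -> T -> Prop) :
  (forall t, A t -> exists i, r i t) ->
  (forall i t t', A t -> A t' -> r i t -> r i t' -> t = t') -> finite_set A.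
Proof.
move=> ex uniq_r.
have [[t0 _]|A0] := pselect (A !=set0); last first.
  rewrite (_ : A = set0); first exact: finite_set0.
  by apply/seteqP; split=> // t At; apply: A0; exists t.
have /choice[g gP] i : exists t, (exists t, A t /\ r i t) -> A t /\ r i t.
  by have [[t tP]|h] := pselect (exists t, A t /\ r i t); [exists t|exists t0].
have : finite_set (g @` setT) by apply/finite_image/finite_finset.
apply: sub_finite_set => t At; have [i ri] := ex t At.
by exists i => //; have [|Ag rg] := gP i; [exists t|apply: (uniq_r i)].
Qed.

(** * Modules over rings without unit *)

Section NonUnitalTheory.
Variable R : nonUnitalRingType.
Implicit Types (a b : R) (M N : nonUnitalLmodType R).

Lemma numul0r a : numul 0 a = 0.
Proof. by apply: (addrI (numul 0 a)); rewrite -numulDl !addr0. Qed.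

Lemma numulr0 a : numul a 0 = 0.
Proof. by apply: (addrI (numul a 0)); rewrite -numulDr !addr0. Qed.

Lemma numulNr a b : numul (- a) b = - numul a b.
Proof. by apply: (addrI (numul a b)); rewrite -numulDl !subrr numul0r. Qed.

Lemma numulrN a b : numul a (- b) = - numul a b.
Proof. by apply: (addrI (numul a b)); rewrite -numulDr !subrr numulr0. Qed.

Lemma numulBl a b c : numul (a - b) c = numul a c - numul b c.
Proof. by rewrite numulDl numulNr. Qed.

Lemma numulBr a b c : numul a (b - c) = numul a b - numul a c.
Proof. by rewrite numulDr numulrN. Qed.

Lemma numul_suml (I : Type) (s : seq I) (P : pred I) (F : I -> R) b :
  numul (\sum_(i <- s | P i) F i) b = \sum_(i <- s | P i) numul (F i) b.
Proof.
exact: (big_morph (fun a => numul a b) (fun x y => numulDl x y b) (numul0r b)).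
Qed.

Lemma numul_sumr (I : Type) (s : seq I) (P : pred I) (F : I -> R) a :
  numul a (\sum_(i <- s | P i) F i) = \sum_(i <- s | P i) numul a (F i).
Proof. exact: (big_morph (numul a) (numulDr a) (numulr0 a)). Qed.

Section Module.
Variable M : nonUnitalLmodType R.
Implicit Types m n : M.

Lemma nuact0r a : nuact a (0 : M) = 0.
Proof. by apply: (addrI (nuact a 0)); rewrite -nuactDr !addr0. Qed.

Lemma nuact0l m : nuact (0 : R) m = 0.
Proof. by apply: (addrI (nuact (0 : R) m)); rewrite -nuactDl !addr0. Qed.

Lemma nuactNr a m : nuact a (- m) = - nuact a m.
Proof. by apply: (addrI (nuact a m)); rewrite -nuactDr !subrr nuact0r. Qed.

Lemma nuactNl a m : nuact (- a) m = - nuact a m.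
Proof. by apply: (addrI (nuact a m)); rewrite -nuactDl !subrr nuact0l. Qed.

Lemma nuactBr a m n : nuact a (m - n) = nuact a m - nuact a n.
Proof. by rewrite nuactDr nuactNr. Qed.

Lemma nuactBl a b m : nuact (a - b) m = nuact a m - nuact b m.
Proof. by rewrite nuactDl nuactNl. Qed.

Lemma nuact_suml (I : Type) (s : seq I) (P : pred I) (F : I -> R) m :
  nuact (\sum_(i <- s | P i) F i) m = \sum_(i <- s | P i) nuact (F i) m.
Proof.
exact: (big_morph (fun a => nuact a m) (fun x y => nuactDl x y m) (nuact0l m)).
Qed.

Lemma nuact_sumr (I : Type) (s : seq I) (P : pred I) (F : I -> M) a :
  nuact a (\sum_(i <- s | P i) F i) = \sum_(i <- s | P i) nuact a (F i).
Proof. exact: (big_morph (nuact a) (nuactDr a) (nuact0r a)). Qed.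

Hypothesis sM : simple_module M.

(** The vectors killed by all of [R] form a submodule, and it is not the whole of [M] because some
    product is nonzero. *)
Lemma simple_ann m : (forall a, nuact a m = 0) -> m = 0.
Proof.
move=> am; have [[b [n bn]] sub] := sM.
have [|N0|NT] := sub [set m | forall a, nuact a m = 0].
- split=> [a|x y ax ay a|a x ax b'].
  + by rewrite nuact0r.
  + by rewrite nuactBr ax ay subrr.
  + by rewrite nuactA ax.
- have : [set m | forall a, nuact a m = 0] m by [].
  by rewrite N0.
- have : [set m | forall a, nuact a m = 0] n by rewrite NT.
  by move=> /(_ b).
Qed.

(** Without a unit, [m] need not lie in [R m] a priori; it is [simple_ann] that excludes [R m = 0],
    so that [R m] is everything. *)
Lemma simple_gen m n : m <> 0 -> exists a, nuact a m = n.
Proof.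
move=> m0; have [_ sub] := sM.
have [|N0|NT] := sub [set n | exists a, nuact a m = n].
- split=> [|_ _ [a <-] [b <-]|a _ [b <-]].
  + by exists 0; rewrite nuact0l.
  + by exists (a - b); rewrite nuactBl.
  + by exists (numul a b); rewrite nuactA.
- case: m0; apply: simple_ann => a.
  have : [set n | exists a, nuact a m = n] (nuact a m) by exists a.
  by rewrite N0.
- have : [set n | exists a, nuact a m = n] n by rewrite NT.
  by [].
Qed.

End Module.

(** Each module is [R] modulo the annihilator of its chosen vector. The isomorphism sends [a m] to
    [a n]; [F] and [G] choose the coefficients, and equality of the annihilators makes the choice
    irrelevant. *)
Lemma simple_iso M N (m : M) (n : N) :
  simple_module M -> simple_module N -> m <> 0 -> n <> 0 ->
  (forall a, nuact a m = 0 <-> nuact a n = 0) -> module_iso M N.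
Proof.
move=> sM sN m0 n0 mn.
have annP a b : nuact a m = nuact b m <-> nuact a n = nuact b n.
  split=> ab; apply/eqP; rewrite -subr_eq0 -nuactBl; apply/eqP/mn;
    by rewrite nuactBl ab subrr.
have [F FP] := choice (fun x => simple_gen sM x m0).
have [G GP] := choice (fun x => simple_gen sN x n0).
pose f x : N := nuact (F x) n.
have fE a : f (nuact a m) = nuact a n by apply/annP; rewrite FP.
have fB : zmod_morphism f.
  by move=> x y; rewrite -(FP x) -(FP y) -nuactBl !fE nuactBl.
pose fM := GRing.isZmodMorphism.Build M N f fB.
pose fA : {additive M -> N} := HB.pack f fM.
exists fA; split.
  exists (fun y => nuact (G y) m) => x /=.
    by rewrite -{2}(FP x); apply/annP; rewrite GP -[RHS](fE (F x)) FP.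
  by rewrite fE GP.
by move=> a x /=; rewrite -{1}(FP x) nuactA fE /f nuactA.
Qed.

(* If a m = 0 and b a n = n, then u b a annihilates m but not n; so the
   hypothesis forces m and n to have the same annihilator. *)
Lemma simple_corner_iso M N (u : R) (m : M) (n : N) :
  simple_module M -> simple_module N -> m <> 0 -> n <> 0 ->
  nuact u n = n -> nuact u m = m ->
  (forall a, nuact u (nuact a m) = 0 <-> nuact u (nuact a n) = 0) ->
  module_iso M N.
Proof.
move=> sM sN m0 n0 un um mn; apply: (simple_iso sM sN m0 n0) => a; split=> am.
  apply: contrapT => an; have [b bn] := simple_gen sN n an.
  apply: n0; rewrite -un -{1}bn [nuact b _]nuactA; apply/mn.
  by rewrite -nuactA am !nuact0r.
apply: contrapT => an; have [b bn] := simple_gen sM m an.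
apply: m0; rewrite -um -{1}bn [nuact b _]nuactA; apply/mn.
by rewrite -nuactA am !nuact0r.
Qed.

Record left_ideal := LeftIdeal {
  left_ideal_set :> R -> Prop;
  left_ideal0 : left_ideal_set 0;
  left_idealB : forall a b,
    left_ideal_set a -> left_ideal_set b -> left_ideal_set (a - b);
  left_idealM : forall a b, left_ideal_set b -> left_ideal_set (numul a b)
}.

Section LeftIdealQuotient.
Variable J : left_ideal.

Lemma left_idealN a : J a -> J (- a).
Proof. by rewrite -sub0r; apply: left_idealB; exact: left_ideal0. Qed.

Lemma left_idealD a b : J a -> J b -> J (a + b).
Proof. by move=> Ja Jb; rewrite -[b]opprK; apply/left_idealB/left_idealN. Qed.

Definition left_ideal_eqb a b : bool := `[< J (a - b) >].

Lemma left_ideal_eqb_refl : reflexive left_ideal_eqb.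
Proof. by move=> x; apply/asboolP; rewrite subrr; exact: left_ideal0. Qed.

Lemma left_ideal_eqb_sym : symmetric left_ideal_eqb.
Proof.
by move=> x y; apply: asbool_equiv_eq; split=> /left_idealN; rewrite opprB.
Qed.

Lemma left_ideal_eqb_trans : transitive left_ideal_eqb.
Proof.
move=> y x z /asboolP xy /asboolP yz; apply/asboolP.
by have := left_idealD xy yz; rewrite addrA subrK.
Qed.

Canonical left_ideal_equiv := EquivRel left_ideal_eqb
  left_ideal_eqb_refl left_ideal_eqb_sym left_ideal_eqb_trans.

Definition left_ideal_quot := {eq_quot left_ideal_equiv}.
Local Notation Q := left_ideal_quot.

HB.instance Definition _ := Choice.on Q.
HB.instance Definition _ := EqQuotient.on Q.

Lemma liq_piP a b : J (a - b) <-> \pi_Q a = \pi_Q b.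
Proof.
by split=> [xy|/eqmodP/asboolP//]; apply/eqmodP/asboolP.
Qed.

Lemma liq_reprK a : J (repr (\pi_Q a) - a).
Proof. by apply/liq_piP; rewrite reprK. Qed.

Lemma liq_ind (P : Q -> Prop) : (forall a, P (\pi_Q a)) -> forall x, P x.
Proof. by move=> Ppi x; rewrite -[x]reprK. Qed.

Definition liq_opp (x : Q) : Q := \pi_Q (- repr x).
Definition liq_add (x y : Q) : Q := \pi_Q (repr x + repr y).
Definition liq_act (a : R) (x : Q) : Q := \pi_Q (numul a (repr x)).

Lemma liq_piN a : liq_opp (\pi_Q a) = \pi_Q (- a).
Proof.
by apply/liq_piP; rewrite -opprD; apply/left_idealN/liq_reprK.
Qed.

Lemma liq_piD a b : liq_add (\pi_Q a) (\pi_Q b) = \pi_Q (a + b).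
Proof.
by apply/liq_piP; rewrite opprD addrACA; apply: left_idealD; exact: liq_reprK.
Qed.

Lemma liq_piA a b : liq_act a (\pi_Q b) = \pi_Q (numul a b).
Proof.
by apply/liq_piP; rewrite -numulBr; apply/left_idealM/liq_reprK.
Qed.

Let liq_pi := (liq_piN, liq_piD, liq_piA).

Fact liq_addrA : associative liq_add.
Proof.
elim/liq_ind=> x; elim/liq_ind=> y; elim/liq_ind=> z.
by rewrite !liq_pi addrA.
Qed.

Fact liq_addrC : commutative liq_add.
Proof. by elim/liq_ind=> x; elim/liq_ind=> y; rewrite !liq_pi addrC. Qed.

Fact liq_add0r : left_id (\pi_Q 0) liq_add.
Proof. by elim/liq_ind=> x; rewrite !liq_pi add0r. Qed.

Fact liq_addNr : left_inverse (\pi_Q 0) liq_opp liq_add.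
Proof. by elim/liq_ind=> x; rewrite !liq_pi addNr. Qed.

HB.instance Definition _ :=
  GRing.isZmodule.Build Q liq_addrA liq_addrC liq_add0r liq_addNr.

Fact liq_actA a b x : liq_act a (liq_act b x) = liq_act (numul a b) x.
Proof. by elim/liq_ind: x => x; rewrite !liq_pi numulA. Qed.

Fact liq_actDl a b x : liq_act (a + b) x = liq_act a x + liq_act b x.
Proof.
by elim/liq_ind: x => x; rewrite /GRing.add /= !liq_pi -numulDl.
Qed.

Fact liq_actDr a x y : liq_act a (x + y) = liq_act a x + liq_act a y.
Proof.
elim/liq_ind: x => x; elim/liq_ind: y => y.
by rewrite /GRing.add /= !liq_pi -numulDr.
Qed.

HB.instance Definition _ :=
  Zmodule_isNonUnitalLmodule.Build R Q liq_actA liq_actDl liq_actDr.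

End LeftIdealQuotient.

(** The vector stands for the image of [u] in a simple quotient of [R] by a left ideal containing
    [I]. *)
Definition realizes (u : R) (I : set R) M :=
  exists m : M, [/\ m <> 0, nuact u m = m & forall a, I a -> nuact a m = 0].

(** Here [u] is a right unit modulo [I], so that a left ideal containing [I] is proper exactly when
    it avoids [u]. Zorn's lemma then gives a maximal one. *)
Lemma exists_simple (I : left_ideal) (u : R) :
  ~ I u -> (forall a, I (a - numul a u)) ->
  exists M, simple_module M /\ realizes u (left_ideal_set I) M.
Proof.
move=> Iu Iau.
pose good (A : set R) := [/\ left_ideal_set I `<=` A, ~ A u,
  (forall a b, A a -> A b -> A (a - b)) & (forall a b, A b -> A (numul a b))].
have goodI : good (left_ideal_set I).
  by split=> //; [exact: left_idealB|exact: left_idealM].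
have [F FP Ftot|A [PA Amax]] := @Zorn_bigcup R [set A | A = set0 \/ good A].
  have [[A0 FA0 A00]|F0] := pselect (exists2 A, F A & A !=set0); last first.
    left; apply/seteqP; split=> // x [A FA Ax].
    by apply: F0; exists A => //; exists x.
  have gd A x : F A -> A x -> good A.
    by move=> FA Ax; case: (FP A FA) => // A_0; rewrite A_0 in Ax.
  right; split.
  - have [x A0x] := A00; have [IA _ _ _] := gd _ _ FA0 A0x.
    by move=> y /IA A0y; exists A0.
  - by case=> A FA Au; have [_ + _ _] := gd _ _ FA Au.
  - move=> a b [A FA Aa] [B FB Bb].
    have [_ _ BA _] := gd _ _ FA Aa; have [_ _ BB _] := gd _ _ FB Bb.
    by case: (Ftot A B FA FB) => s;
      [exists B => //; apply: BB => //; exact: s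
      |exists A => //; apply: BA => //; exact: s].
  - move=> a b [A FA Ab]; exists A => //.
    by have [_ _ _ +] := gd _ _ FA Ab; apply.
have {}PA : good A.
  case: PA => // A0; case: (Amax (left_ideal_set I)); last by right.
  rewrite A0 properEneq; split=> //; apply/eqP => /esym I0.
  by have := left_ideal0 I; rewrite I0.
have [IA Au AB AM] := PA.
have A0 : A 0 by apply/IA/left_ideal0.
pose J := LeftIdeal A0 AB AM.
pose M : nonUnitalLmodType R := left_ideal_quot J.
pose p a : M := \pi_(left_ideal_quot J) a.
have pE a b : J (a - b) <-> p a = p b by exact: liq_piP.
have pA a b : nuact a (p b) = p (numul a b) by rewrite /nuact /= liq_piA.
have pB a b : p a - p b = p (a - b).
  by rewrite /GRing.add /GRing.opp /= liq_piN liq_piD.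
have p0 a : p a = 0 <-> A a.
  by rewrite -[X in _ <-> A X]subr0; split=> /pE.
have pu a : p (numul a u) = p a by apply/esym/pE/IA/Iau.
exists M; split; last first.
  exists (p u); split; first by move/p0.
    by rewrite pA pu.
  by move=> a Ia; rewrite pA pu; apply/p0/IA.
split; first by exists u, (p u); rewrite pA pu => /p0.
move=> N [N0 NB NM].
(* A submodule containing the image of [u] contains every [a u = a]. Otherwise its preimage is a
   left ideal avoiding [u], which maximality forces to be [A]. *)
have [Nu|Nu] := pselect (N (p u)).
  right; apply/seteqP; split=> // x _; elim/liq_ind: x => x.
  by rewrite -/(p x) -pu -pA; exact: NM.
left; apply/seteqP; split=> [x|_ ->//]; elim/liq_ind: x => x; rewrite -/(p x).
move=> Nx; apply/p0; apply: contrapT => Ax.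
apply: (Amax [set a | N (p a)]).
  rewrite properEneq; split.
    by apply/eqP => AE; apply: Ax; rewrite AE.
  by move=> a /p0; rewrite /= => ->.
right; split=> //.
- by move=> a /IA/p0; rewrite /= => ->.
- by move=> a b /= Na Nb; rewrite -pB; exact: NB.
- by move=> a b /= Nb; rewrite -pA; exact: NM.
Qed.

End NonUnitalTheory.

(** * Walks and monomials *)

Section Walks.
Variable E : digraph.
Implicit Types (u v w : vertex E) (e f : edge E) (p q : seq (edge E)).
Implicit Types (H : set (vertex E)).

(** Both endpoints are recorded so that paths of length 0 are included and concatenation needs no
    case distinction. *)
Fixpoint walk v p w : bool :=
  if p is e :: p' then (src e == v) && walk (rng e) p' w else v == w.

Lemma walk_cat v p q w :
  walk v (p ++ q) w <-> exists2 u, walk v p u & walk u q w.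
Proof.
elim: p v => [|e p IH] v /=.
  by split=> [?|[u /eqP<-]//]; exists v.
split=> [/andP[->]/IH[u pu uq]|[u /andP[-> pu] uq]]; first by exists u.
by apply/IH; exists u.
Qed.

Lemma walk_inj v p w w' : walk v p w -> walk v p w' -> w = w'.
Proof.
by elim: p v => [|e p IH] v /= => [/eqP<- /eqP|/andP[_ +] /andP[_]]; last exact: IH.
Qed.

Lemma walkP v e p w :
  walk v (e :: p) w <-> [/\ is_path e p, src e = v & rng (last e p) = w].
Proof.
rewrite /is_path; elim: p v e => [|f p IH] v e.
  by split=> /= [/andP[/eqP-> /eqP->]|[_ -> ->]]; rewrite ?eqxx.
split=> [/andP[/eqP ev /IH[pp fe pw]]|].
  by split=> //=; rewrite fe eqxx.
move=> /= [/andP[/eqP ef pp] ev pw].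
rewrite ev eqxx /=; have /IH/= := And3 pp (esym ef) pw.
by [].
Qed.

Lemma reachesP u v : reaches u v <-> exists p, walk u p v.
Proof.
split=> [[->|[e [p epv]]]|[[|e p]]].
- by exists [::] => /=.
- by exists (e :: p); apply/walkP.
- by move=> /= /eqP; left.
- by move/walkP => epv; right; exists e, p.
Qed.

Lemma hereditary_edgeP H :
  hereditary H <-> forall e, H (src e) -> H (rng e).
Proof.
split=> [hH e He|hH v w Hv /reachesP[p]].
  by apply: (hH _ _ He); apply/reachesP; exists [:: e]; rewrite /= !eqxx.
by elim: p v Hv => [|e p IH] v Hv /= => [/eqP<-//|/andP[/eqP ev]];
  apply/IH/hH; rewrite ev.
Qed.

Lemma hereditary_walk H v p w : hereditary H -> walk v p w -> H v -> H w.
Proof. by move=> hH vw Hv; apply: (hH v) => //; apply/reachesP; exists p. Qed.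

(** If two edges at positions [i < j] have the same source, the edges from [i] up to [j] form a
    strictly shorter closed walk; induction on the length concludes. *)
Lemma closed_walk_cycle v e p : walk v (e :: p) v ->
  exists f q, is_cycle f q /\ {subset f :: q <= e :: p}.
Proof.
have [n] := ubnP (size p); elim: n v e p => // n IH v e p /ltnSE pn vv.
have [uq|nuq] := boolP (uniq [seq src f | f <- e :: p]).
  exists e, p; split=> //; split=> //.
  by have /walkP[ep es rv] := vv; split=> //; rewrite rv es.
have /(uniqPn (src e))[i [j [ij]]] := nuq.
rewrite size_map => jn; rewrite !(nth_map e) //; last exact: ltn_trans jn.
move=> eij; pose c := take (j - i) (drop i (e :: p)).
have cE : e :: p = take i (e :: p) ++ c ++ drop j (e :: p).
  rewrite /c -{2}(subnKC (ltnW ij)) addnC -drop_drop.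
  by rewrite !cat_take_drop.
have szc : size c = (j - i)%N.
  by rewrite size_takel // size_drop leq_sub2r // ltnW.
have srcn k p' u w : walk u p' w -> (k < size p')%N ->
    forall x, walk u (take k p') x -> x = src (nth e p' k).
  elim: p' k u => // f p' IHp [|k] u /=; first by move=> /andP[/eqP-> _] _ x /eqP.
  by move=> /andP[_ wp] kp x /andP[_]; exact: (IHp k _ wp kp).
move: (vv); rewrite {1}cE => /walk_cat[x wx /walk_cat[y wy wd]].
have xE := srcn _ _ _ _ vv (ltn_trans ij jn) _ wx.
have tj : take j (e :: p) = take i (e :: p) ++ c.
  rewrite {1}cE catA take_size_cat // size_cat szc size_takel ?subnKC ?(ltnW ij) //.
  exact/ltnW/(ltn_trans ij jn).
have yE : y = src (nth e (e :: p) j).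
  by apply: (srcn _ _ _ _ vv jn); rewrite tj; apply/walk_cat; exists x.
have xy : x = y by rewrite xE yE eij.
case cc: c => [|f q]; first by move: szc ij; rewrite cc /= -subn_gt0 => <-.
rewrite cc -xy in wy.
have [|f' [q' [cyc sub]]] := IH x f q _ wy.
  by move: szc jn pn; rewrite cc /=; lia.
exists f', q'; split=> // g /sub; rewrite -cc /c => /mem_take/mem_drop.
by [].
Qed.

Lemma acyclic_walk v e p : acyclic E -> ~~ walk v (e :: p) v.
Proof.
by move=> ac; apply/negP => /closed_walk_cycle[f [q [/ac]]].
Qed.

End Walks.

Section Elements.
Variables (K : fieldType) (E : digraph).
Local Notation L := (leavitt_path_algebra K E).
Implicit Types (u v w : vertex E) (e f : edge E) (p q : seq (edge E)).
Implicit Types (a b : L).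
Local Notation "a ** b" := (numul a b) (at level 40, left associativity).

Definition lpa_v v : L := \pi_L (TVertex K v).
Definition lpa_e e : L := \pi_L (TEdge K e).
Definition lpa_g e : L := \pi_L (TGhost K e).

Lemma lpa_vv v w : lpa_v v ** lpa_v w = if v == w then lpa_v v else 0.
Proof.
rewrite /numul /= lpa_piM; case: eqP => [->|vw]; apply/lpa_piP.
  exact: lpa_vertex_idem.
exact: lpa_vertex_orth.
Qed.

Lemma lpa_vid v : lpa_v v ** lpa_v v = lpa_v v.
Proof. by rewrite lpa_vv eqxx. Qed.

Lemma lpa_eK e : lpa_e e ** lpa_v (rng e) = lpa_e e.
Proof. by rewrite /numul /= lpa_piM; apply/lpa_piP/lpa_edge_rng. Qed.

Lemma lpa_gK e : lpa_v (rng e) ** lpa_g e = lpa_g e.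
Proof. by rewrite /numul /= lpa_piM; apply/lpa_piP/lpa_rng_ghost. Qed.

Lemma lpa_ve v e : lpa_v v ** lpa_e e = if src e == v then lpa_e e else 0.
Proof.
have se : lpa_v (src e) ** lpa_e e = lpa_e e.
  by rewrite /numul /= lpa_piM; apply/lpa_piP/lpa_src_edge.
rewrite -se numulA lpa_vv [v == _]eq_sym.
by case: eqP => [->|_]; rewrite ?numul0r.
Qed.

Lemma lpa_gv v e : lpa_g e ** lpa_v v = if src e == v then lpa_g e else 0.
Proof.
have se : lpa_g e ** lpa_v (src e) = lpa_g e.
  by rewrite /numul /= lpa_piM; apply/lpa_piP/lpa_ghost_src.
rewrite -se -numulA lpa_vv.
by case: eqP => [->|_]; rewrite ?numulr0.
Qed.

Lemma lpa_ge e f : lpa_g e ** lpa_e f = if e == f then lpa_v (rng e) else 0.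
Proof.
rewrite /numul /= lpa_piM; case: eqP => [->|ef]; apply/lpa_piP.
  exact: lpa_ghost_edge.
exact: lpa_ghost_edge_neq.
Qed.

Lemma lpa_vsum v : regular v ->
  lpa_v v = \sum_(e <- fset_set (out_edges v)) lpa_e e ** lpa_g e.
Proof.
move=> rv; rewrite {1}/lpa_v; have /lpa_piP -> := lpa_regular K rv.
elim: (enum_fset _) => [|e s IH]; first by rewrite !big_nil.
by rewrite !big_cons -IH /numul /GRing.add /= lpa_piM lpa_piD.
Qed.

(** The vertex [w] closes the product, so that the empty list gives [w] itself; a list that is not a
    walk ending at [w] gives 0. Likewise for the ghost path, whose factors come in the reverse
    order. *)
Definition lpa_path p w : L := foldr (fun e a => lpa_e e ** a) (lpa_v w) p.
Definition lpa_ghost p w : L := foldr (fun e a => a ** lpa_g e) (lpa_v w) p.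

Lemma lpa_pathv p w v :
  lpa_path p w ** lpa_v v = if w == v then lpa_path p w else 0.
Proof.
elim: p => [|e p IH] /=; first by rewrite lpa_vv.
by rewrite -numulA IH; case: ifP; rewrite ?numulr0.
Qed.

Lemma lpa_vghost p w v :
  lpa_v v ** lpa_ghost p w = if w == v then lpa_ghost p w else 0.
Proof.
elim: p => [|e p IH] /=.
  by rewrite lpa_vv eq_sym; case: eqP => [->|].
by rewrite numulA IH; case: ifP; rewrite ?numul0r.
Qed.

Lemma lpa_vpath v p w :
  lpa_v v ** lpa_path p w = if walk v p w then lpa_path p w else 0.
Proof.
elim: p v => [|e p IH] v /=; first by rewrite lpa_vv; case: eqP => [->|].
rewrite numulA lpa_ve; case: eqP => [_|]; rewrite ?numul0r //=.
by rewrite -{1}lpa_eK -numulA IH; case: ifP => //; rewrite numulr0.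
Qed.

Lemma lpa_ghostv v p w :
  lpa_ghost p w ** lpa_v v = if walk v p w then lpa_ghost p w else 0.
Proof.
elim: p v => [|e p IH] v /=.
  by rewrite lpa_vv eq_sym.
rewrite -numulA lpa_gv; case: eqP => [_|]; rewrite ?numulr0 //=.
by rewrite -{1}lpa_gK numulA IH; case: ifP => //; rewrite numul0r.
Qed.

Lemma lpa_path_cat p q v w :
  lpa_path p v ** lpa_path q w = if walk v q w then lpa_path (p ++ q) w else 0.
Proof.
elim: p => [|e p IH] /=; first exact: lpa_vpath.
by rewrite -numulA IH; case: ifP; rewrite ?numulr0.
Qed.

Lemma lpa_ghost_cat p q v w :
  lpa_ghost q w ** lpa_ghost p v = if walk v q w then lpa_ghost (p ++ q) w else 0.
Proof.
elim: p => [|e p IH] /=; first exact: lpa_ghostv.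
by rewrite numulA IH; case: ifP; rewrite ?numul0r.
Qed.

Lemma lpa_ghost_rcons e p :
  lpa_g e ** lpa_ghost p (src e) = lpa_ghost (rcons p e) (rng e).
Proof.
elim: p => [|f p IH] /=; first by rewrite lpa_gv eqxx lpa_gK.
by rewrite numulA IH.
Qed.

(** By relation (3), edges and ghost edges cancel one by one from the middle of the product, which
    vanishes at the first disagreement. What survives is the part of the longer list that
    remains. *)
Lemma lpa_ghost_path_short p q v w u : walk v p w -> (size p <= size q)%N ->
  lpa_ghost q u ** lpa_path p w =
    if take (size p) q == p then lpa_ghost (drop (size p) q) u ** lpa_v w else 0.
Proof.
elim: p v q => [|e p IH] v q; first by rewrite take0 drop0 eqxx.
case: q => [|f q] //= /andP[_ wp]; rewrite ltnS => pq.
rewrite -numulA [lpa_g f ** _]numulA lpa_ge eqseq_cons.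
case: eqP => [->|_] /=; last by rewrite numul0r numulr0.
by rewrite lpa_vpath wp (IH _ _ wp pq).
Qed.

Lemma lpa_ghost_path_long p q v w u : walk v q u -> (size q <= size p)%N ->
  lpa_ghost q u ** lpa_path p w =
    if take (size q) p == q then lpa_v u ** lpa_path (drop (size q) p) w else 0.
Proof.
elim: q v p => [|e q IH] v p; first by rewrite take0 drop0 eqxx.
case: p => [|f p] //= /andP[_ wp]; rewrite ltnS => pq.
rewrite -numulA [lpa_g e ** _]numulA lpa_ge eqseq_cons.
case: (eqVneq e f) wp => [->|_] wp; last first.
  by rewrite numul0r numulr0.
by rewrite /= numulA lpa_ghostv wp (IH _ _ wp pq).
Qed.

End Elements.

(** * Spanning of L_K(E) by the monomials p q^* *)

Section Span.
Variables (K : fieldType) (E : digraph).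
Local Notation L := (leavitt_path_algebra K E).
Implicit Types (u v w : vertex E) (e f : edge E) (p q : seq (edge E)).
Implicit Types (a b : L).
Local Notation "a ** b" := (numul a b) (at level 40, left associativity).

Inductive lpa_spanned : L -> Prop :=
| lpa_spanned0 : lpa_spanned 0
| lpa_spannedD a b : lpa_spanned a -> lpa_spanned b -> lpa_spanned (a + b)
| lpa_spanned_mon (k : K) w p q :
    lpa_spanned (k *: (lpa_path K p w ** lpa_ghost K q w)).

Lemma lpa_spannedZ k a : lpa_spanned a -> lpa_spanned (k *: a).
Proof.
elim=> [|b c _ IHb _ IHc|l w p q]; first by rewrite scaler0; constructor.
  by rewrite scalerDr; constructor.
by rewrite scalerA; constructor.
Qed.

Lemma lpa_spannedM (x : L) :
  (forall w p q, lpa_spanned (x ** (lpa_path K p w ** lpa_ghost K q w))) ->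
  forall a, lpa_spanned a -> lpa_spanned (x ** a).
Proof.
move=> xm a; elim=> [|b c _ IHb _ IHc|l w p q]; first by rewrite numulr0; constructor.
  by rewrite numulDr; constructor.
by rewrite -nuscalerAr; apply/lpa_spannedZ.
Qed.

Lemma lpa_spanned1 w p q : lpa_spanned (lpa_path K p w ** lpa_ghost K q w).
Proof. by rewrite -[X in lpa_spanned X]scale1r; constructor. Qed.

Lemma lpa_spannedP a : lpa_spanned a.
Proof.
elim/lpa_ind: a => x.
have oN (y : L) : - y = (-1) *: y by rewrite scaleN1r.
(* The induction on terms is strengthened to left multiplication by the term, which the product case
   requires. *)
suff [] : lpa_spanned (\pi_L x) /\
    forall a, lpa_spanned a -> lpa_spanned (\pi_L x ** a) by [].
elim: x => [v|e|e||x [IHx IHx']|x [IHx IHx'] y [IHy IHy']|k x [IHx IHx']|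
    x [IHx IHx'] y [IHy IHy']].
- split; first by have := lpa_spanned1 v [::] [::]; rewrite /= lpa_vid.
  apply: lpa_spannedM => w p q; rewrite -/(lpa_v K v) numulA lpa_vpath.
  by case: ifP => _; [exact: lpa_spanned1|rewrite numul0r; constructor].
- split.
    by have := lpa_spanned1 (rng e) [:: e] [::]; rewrite /= -numulA lpa_vid lpa_eK.
  apply: lpa_spannedM => w p q; rewrite -/(lpa_e K e) numulA.
  exact: (lpa_spanned1 w (e :: p) q).
- split.
    by have := lpa_spanned1 (rng e) [::] [:: e]; rewrite /= numulA lpa_vid lpa_gK.
  apply: lpa_spannedM => w [|f p] q; rewrite -/(lpa_g K e) /=.
    rewrite numulA lpa_gv; case: eqP => [<-|_].
      have := lpa_spanned1 (rng e) [::] (rcons q e).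
      by rewrite /= lpa_vghost eqxx -lpa_ghost_rcons.
    by rewrite numul0r; constructor.
  rewrite !numulA lpa_ge; case: eqP => [_|_].
    rewrite lpa_vpath; case: ifP => _; first exact: lpa_spanned1.
    by rewrite numul0r; constructor.
  by rewrite !numul0r; constructor.
- by split=> [|a sa]; [constructor|rewrite numul0r; constructor].
- have -> : \pi_L (TOpp x) = - \pi_L x by rewrite /GRing.opp /= lpa_piN.
  split=> [|a sa]; first by rewrite oN; apply: lpa_spannedZ.
  by rewrite numulNr oN; apply: lpa_spannedZ; exact: IHx'.
- have -> : \pi_L (TAdd x y) = \pi_L x + \pi_L y by rewrite /GRing.add /= lpa_piD.
  split=> [|a sa]; first by constructor.
  by rewrite numulDl; constructor; [exact: IHx'|exact: IHy'].
- have -> : \pi_L (TScale k x) = k *: \pi_L x by rewrite /GRing.scale /= lpa_piZ.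
  split=> [|a sa]; first exact: lpa_spannedZ.
  by rewrite -nuscalerAl; apply/lpa_spannedZ/IHx'.
- have -> : \pi_L (TMul x y) = \pi_L x ** \pi_L y by rewrite /numul /= lpa_piM.
  split=> [|a sa]; first exact: IHx'.
  by rewrite -numulA; apply/IHx'/IHy'.
Qed.

End Span.

(** * Functions on boundary paths *)

Section PathModel.
Variables (K : fieldType) (E : digraph) (H : set (vertex E)).
Hypothesis hH : hereditary H.
Local Notation L := (leavitt_path_algebra K E).
Implicit Types (u v w : vertex E) (e f : edge E) (p q : seq (edge E)).
Implicit Types (a b : L).
Local Notation "a ** b" := (numul a b) (at level 40, left associativity).

(* A finite path ending at w is continued by the constant sequence inl w. *)
Definition stream := nat -> vertex E + edge E.

Implicit Types (x y : stream).

Definition step_src (z : vertex E + edge E) : vertex E :=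
  match z with inl v => v | inr e => src e end.

(** Paths avoid [H], so that the vertices of [H] act as zero. A path may stop only at a sink or an
    infinite emitter, that is, where relation (4) is not imposed. *)
Definition step_ok z :=
  ~ H (step_src z) /\ (if z is inl w then ~ regular w else True).

Definition step_link z z' :=
  match z with inl w => z' = inl w | inr e => step_src z' = rng e end.

Definition boundary_path x := forall n, step_ok (x n) /\ step_link (x n) (x n.+1).

Definition stream_tail x : stream := fun n => x n.+1.
Definition stream_cons e x : stream := fun n => if n is n'.+1 then x n' else inr e.

Lemma boundary_path_tail x : boundary_path x -> boundary_path (stream_tail x).
Proof. by move=> bx n; exact: bx. Qed.

Lemma boundary_path_cons e x : boundary_path x -> step_src (x 0%N) = rng e ->
  boundary_path (stream_cons e x).
Proof.
move=> bx xe [|n]; last exact: bx.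
split=> //; split=> //= He.
have [[+ _] _] := bx 0%N; rewrite xe; apply.
by move/hereditary_edgeP: hH; exact.
Qed.

Lemma stream_consK e x : x 0%N = inr e -> stream_cons e (stream_tail x) = x.
Proof. by move=> xe; apply/funext => -[|n]. Qed.

Lemma boundary_path_link e x : boundary_path x -> x 0%N = inr e ->
  step_src (stream_tail x 0%N) = rng e.
Proof. by move=> bx xe; have [_] := bx 0%N; rewrite xe. Qed.

(* The integer records a degree: every edge shifts it by 1. *)
Definition path_point := (stream * int)%type.

Implicit Types (g h : path_point -> K) (z : path_point).

Definition on_path z : bool := `[< boundary_path z.1 >].

(** An edge acts by pullback along removal of that edge from the front, a ghost edge by pullback
    along prepending it. All functions are allowed, not only finitely supported ones: the vectors
    used for cycles are periodic in the degree. *)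
Fixpoint term_act (t : lpa_term K E) g : path_point -> K :=
  match t with
  | TVertex v => fun z =>
      if on_path z && (step_src (z.1 0%N) == v) then g z else 0
  | TEdge e => fun z =>
      if on_path z && (z.1 0%N == inr e) then g (stream_tail z.1, z.2 - 1) else 0
  | TGhost e => fun z =>
      if on_path z && (step_src (z.1 0%N) == rng e)
      then g (stream_cons e z.1, z.2 + 1) else 0
  | TZero => fun=> 0
  | TOpp t => fun z => - term_act t g z
  | TAdd t t' => fun z => term_act t g z + term_act t' g z
  | TScale k t => fun z => k * term_act t g z
  | TMul t t' => term_act t (term_act t' g)
  end.

Lemma term_actD t g h z :
  term_act t (fun z => g z + h z) z = term_act t g z + term_act t h z.
Proof.
elim: t g h z => [v|e|e||t IH|t IH t' IH'|k t IH|t IH t' IH'] g h z /=.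
- by case: ifP; rewrite ?addr0.
- by case: ifP; rewrite ?addr0.
- by case: ifP; rewrite ?addr0.
- by rewrite addr0.
- by rewrite IH opprD.
- by rewrite IH IH' addrACA.
- by rewrite IH mulrDr.
- by rewrite -IH; congr term_act; apply/funext => {}z; exact: IH'.
Qed.

Lemma term_actZ t k g z :
  term_act t (fun z => k * g z) z = k * term_act t g z.
Proof.
elim: t g z => [v|e|e||t IH|t IH t' IH'|l t IH|t IH t' IH'] g z /=.
- by case: ifP; rewrite ?mulr0.
- by case: ifP; rewrite ?mulr0.
- by case: ifP; rewrite ?mulr0.
- by rewrite mulr0.
- by rewrite IH mulrN.
- by rewrite IH IH' mulrDr.
- by rewrite IH mulrCA.
- by rewrite -IH; congr term_act; apply/funext => {}z; exact: IH'.
Qed.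

Lemma term_act_sum (I : Type) (s : seq I) (F : I -> lpa_term K E) g z :
  term_act (\big[@TAdd K E/@TZero K E]_(i <- s) F i) g z =
  \sum_(i <- s) term_act (F i) g z.
Proof. by elim: s => [|i s IH]; rewrite ?big_nil // !big_cons /= IH. Qed.

Lemma term_actP t t' : lpa_eq t t' -> term_act t = term_act t'.
Proof.
elim=> {t t'} //.
- by move=> x y z _ -> _ ->.
- by move=> x y _ IH; apply/funext => g /=; rewrite IH.
- by move=> x x' y y' _ IH _ IH'; apply/funext => g /=; rewrite IH IH'.
- by move=> k x y _ IH; apply/funext => g /=; rewrite IH.
- by move=> x x' y y' _ IH _ IH'; apply/funext => g /=; rewrite IH IH'.
- by move=> x y z; apply/funext => g; apply/funext => t /=; rewrite addrA.
- by move=> x y; apply/funext => g; apply/funext => t /=; rewrite addrC.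
- by move=> x; apply/funext => g; apply/funext => t /=; rewrite add0r.
- by move=> x; apply/funext => g; apply/funext => t /=; rewrite addNr.
- by move=> k l x; apply/funext => g; apply/funext => t /=; rewrite mulrA.
- by move=> x; apply/funext => g; apply/funext => t /=; rewrite mul1r.
- by move=> k x y; apply/funext => g; apply/funext => t /=; rewrite mulrDr.
- by move=> k l x; apply/funext => g; apply/funext => t /=; rewrite mulrDl.
- by move=> x y z; apply/funext => g; apply/funext => t /=; rewrite term_actD.
- by move=> k x y; apply/funext => g; apply/funext => t /=; rewrite term_actZ.
- by move=> v; apply/funext => g; apply/funext => t /=; case: (on_path t && _).
- move=> v w vw; apply/funext => g; apply/funext => t /=.
  case: ifP => // /andP[_ /eqP->]; case: ifP => // /andP[_ /eqP]; tauto.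
- move=> e; apply/funext => g; apply/funext => t /=.
  case: ifPn => // tn; case: ifP => // /andP[ot /eqP te].
  by move: tn; rewrite ot te /= eqxx.
- move=> e; apply/funext => g; apply/funext => t /=.
  case: ifP => // /andP[/asboolP ot /eqP te].
  rewrite /on_path /= (boundary_path_link ot te) eqxx andbT.
  by case: asboolP => //; move: (boundary_path_tail ot).
- move=> e; apply/funext => g; apply/funext => t /=.
  by case: (on_path t && _).
- move=> e; apply/funext => g; apply/funext => t /=.
  case: ifP => // /andP[/asboolP ot /eqP te].
  rewrite /on_path /= eqxx andbT.
  by case: asboolP => //; move: (boundary_path_cons ot te).
- move=> e; apply/funext => g; apply/funext => t /=.
  case: ifP => // /andP[/asboolP ot /eqP te].
  rewrite /on_path /= eqxx andbT addrK.
  case: asboolP => //; last by move: (boundary_path_cons ot te).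
  by case: t ot te.
- move=> e f ef; apply/funext => g; apply/funext => t /=.
  case: ifP => // _; case: ifP => // /andP[_ /eqP[]]; tauto.
- move=> v rv; have [fv _] := rv; apply/funext => g; apply/funext => t.
  rewrite term_act_sum /=.
  (* The product e e^* restricts a function to the paths that start with [e]. *)
  have efE e : (if on_path t && (t.1 0%N == inr e) then
      if on_path (stream_tail t.1, t.2 - 1) &&
        (step_src (stream_tail t.1 0%N) == rng e)
      then g (stream_cons e (stream_tail t.1), t.2 - 1 + 1) else 0 else 0) =
      if on_path t && (t.1 0%N == inr e) then g t else 0.
    case: ifP => // /andP[/asboolP ot /eqP te].
    rewrite /on_path /= (boundary_path_link ot te) eqxx andbT subrK.
    rewrite (stream_consK te).
    by case: asboolP => [|]; [case: (t)|move: (boundary_path_tail ot)].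
  under eq_bigr do rewrite efE.
  have [ot|not] /= := boolP (on_path t); last by rewrite big1.
  (* A boundary path cannot stop at the regular vertex [v]. One that leaves [v] has a single first
     edge, so exactly one summand contributes; one that starts elsewhere is killed by both sides. *)
  have [[+ okt] _] := (asboolP _ ot) 0%N.
  case t0: (t.1 0%N) okt => [w|e] /= okt _.
    rewrite big1 //; case: eqP => // wv; case: okt; rewrite wv; exact: rv.
  have [ev|ev] := eqVneq (src e) v.
    rewrite (bigD1_seq e) ?fset_uniq //=; last by rewrite in_fset_set // inE.
    rewrite eqxx big1 ?addr0 // => f fe.
    by case: eqP => // -[ef]; rewrite ef eqxx in fe.
  rewrite big_seq big1 // => f; rewrite in_fset_set // inE => fv'.
  by case: eqP => // -[ef]; rewrite ef fv' eqxx in ev.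
Qed.

Definition lpa_act a g : path_point -> K := term_act (repr a) g.

Lemma lpa_act_pi t g : lpa_act (\pi_L t) g = term_act t g.
Proof. by rewrite /lpa_act (term_actP (lpa_reprK t)). Qed.

Lemma lpa_actM a b g : lpa_act (a ** b) g = lpa_act a (lpa_act b g).
Proof.
elim/lpa_ind: a => s; elim/lpa_ind: b => t.
by rewrite /numul /= lpa_piM !lpa_act_pi.
Qed.

Lemma lpa_actB a b g z : lpa_act (a - b) g z = lpa_act a g z - lpa_act b g z.
Proof.
elim/lpa_ind: a => s; elim/lpa_ind: b => t.
by rewrite /GRing.add /GRing.opp /= lpa_piN lpa_piD !lpa_act_pi.
Qed.

Lemma lpa_actD a b g z : lpa_act (a + b) g z = lpa_act a g z + lpa_act b g z.
Proof.
elim/lpa_ind: a => s; elim/lpa_ind: b => t.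
by rewrite /GRing.add /= lpa_piD !lpa_act_pi.
Qed.

Lemma lpa_act0 g z : lpa_act 0 g z = 0.
Proof. by rewrite /GRing.zero /= lpa_act_pi. Qed.

Lemma lpa_act_sum (I : Type) (s : seq I) (F : I -> L) g z :
  lpa_act (\sum_(i <- s) F i) g z = \sum_(i <- s) lpa_act (F i) g z.
Proof.
by elim: s => [|i s IH]; rewrite ?big_nil ?lpa_act0 // !big_cons lpa_actD IH.
Qed.

Lemma lpa_act_r0 a z : lpa_act a (fun=> 0) z = 0.
Proof.
rewrite -[RHS](mul0r (term_act (repr a) (fun=> 0) z)) -term_actZ.
by congr term_act; apply/funext => ?; rewrite mulr0.
Qed.

(** The annihilator of [g] is a left ideal for which [v] is a right unit, since [v] fixes [g]; so
    [exists_simple] applies. *)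
Lemma simple_of_path_function v g :
  lpa_act (lpa_v K v) g = g -> g <> (fun=> 0) ->
  exists M : nonUnitalLmodType L, simple_module M /\
    realizes (lpa_v K v) [set a | lpa_act a g = fun=> 0] M.
Proof.
move=> vg g0.
pose I := [set a | lpa_act a g = fun=> 0].
have I0 : I 0 by apply/funext => z; rewrite lpa_act0.
have IB a b : I a -> I b -> I (a - b).
  by move=> Ia Ib; apply/funext => z; rewrite lpa_actB Ia Ib subrr.
have IM a b : I b -> I (a ** b).
  by move=> Ib; apply/funext => z; rewrite lpa_actM Ib lpa_act_r0.
apply: (@exists_simple _ (LeftIdeal I0 IB IM)) => /=; first by rewrite /I /= vg.
by move=> a; apply/funext => z; rewrite lpa_actB lpa_actM vg subrr.
Qed.

(** Functions concentrated on one tail of [x]: acting by the edges and ghost edges of [x] only moves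
    [n] and translates [phi]. *)
Definition tail_fun (x : nat -> edge E) n (phi : int -> K) : path_point -> K :=
  fun z => if `[< z.1 = fun k => inr (x (n + k)%N) >] then phi z.2 else 0.

Section InfinitePath.
Variable x : nat -> edge E.
Hypothesis x_path : forall n, rng (x n) = src (x n.+1).
Hypothesis x_out : forall n, ~ H (src (x n)).

Lemma tail_boundary n : boundary_path (fun k => inr (x (n + k)%N)).
Proof. by move=> k; split; [split=> //; exact: x_out|rewrite /= addnS x_path]. Qed.

Lemma act_v_tail n phi :
  lpa_act (lpa_v K (src (x n))) (tail_fun x n phi) = tail_fun x n phi.
Proof.
apply/funext => -[y i]; rewrite lpa_act_pi /= /tail_fun /=.
case: ifPn => //; case: asboolP => // ->.
rewrite /on_path /= addn0 eqxx andbT => /asboolPn; case; exact: tail_boundary.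
Qed.

Lemma act_e_tail n phi :
  lpa_act (lpa_e K (x n)) (tail_fun x n.+1 phi) =
  tail_fun x n (fun i => phi (i - 1)).
Proof.
apply/funext => -[y i]; rewrite lpa_act_pi /= /tail_fun /=.
case: (asboolP (y = _)) => [->|yx].
  have -> : stream_tail (fun k => inr (x (n + k)%N)) = fun k => inr (x (n.+1 + k)%N).
    by apply/funext => k; rewrite /stream_tail addnS addSn.
  rewrite /on_path /= addn0 eqxx andbT.
  by case: asboolP => [_|]; [case: asboolP|case; exact: tail_boundary].
case: ifP => // /andP[_ /eqP y0]; case: asboolP => // yt; case: yx.
apply/funext => -[|k]; first by rewrite addn0.
by move/(congr1 (fun s => s k)): yt; rewrite /stream_tail => ->; rewrite addnS addSn.
Qed.

Lemma act_g_tail n phi :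
  lpa_act (lpa_g K (x n)) (tail_fun x n phi) =
  tail_fun x n.+1 (fun i => phi (i + 1)).
Proof.
apply/funext => -[y i]; rewrite lpa_act_pi /= /tail_fun /=.
case: (asboolP (y = _)) => [->|yx].
  have -> : stream_cons (x n) (fun k => inr (x (n.+1 + k)%N)) =
      fun k => inr (x (n + k)%N).
    by apply/funext => -[|k]; rewrite /stream_cons ?addn0 // addnS addSn.
  rewrite /on_path /= addn0 x_path eqxx andbT.
  by case: asboolP => [_|]; [case: asboolP|case; exact: tail_boundary].
case: ifP => // /andP[_ /eqP y0]; case: asboolP => // yt; case: yx.
apply/funext => k.
by move/(congr1 (fun s => s k.+1)): yt; rewrite /stream_cons => ->; rewrite addnS addSn.
Qed.

End InfinitePath.

End PathModel.

(** * Infinite paths *)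

Section Rays.
Variables (K : fieldType) (E : digraph).
Local Notation L := (leavitt_path_algebra K E).
Implicit Types (u v w : vertex E) (e f : edge E) (p q : seq (edge E)).
Implicit Types (a b : L) (M : nonUnitalLmodType L).
Local Notation "a ** b" := (numul a b) (at level 40, left associativity).

Definition ray := {x : nat -> edge E | forall n, rng (x n) = src (x n.+1)}.

Definition ray_edge (x : ray) := sval x.
Coercion ray_edge : ray >-> Funclass.
Implicit Types (x y : ray).

Lemma rayP x n : rng (x n) = src (x n.+1).
Proof. exact: (svalP x). Qed.

Definition segment x n k := [seq x i | i <- iota n k].

Lemma size_segment x n k : size (segment x n k) = k.
Proof. by rewrite size_map size_iota. Qed.

Lemma segmentD x n k l :
  segment x n (k + l) = segment x n k ++ segment x (n + k) l.
Proof. by rewrite /segment iotaD map_cat. Qed.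

Lemma walk_segment x n k : walk (src (x n)) (segment x n k) (src (x (n + k)%N)).
Proof.
elim: k n => [|k IH] n /=; first by rewrite addn0.
rewrite eqxx rayP addnS -addSn; exact: IH.
Qed.

Lemma take_segment x n k l : (k <= l)%N -> take k (segment x n l) = segment x n k.
Proof.
by move=> kl; rewrite -(subnKC kl) segmentD take_size_cat // size_segment.
Qed.

Lemma drop_segment x n k l :
  (k <= l)%N -> drop k (segment x n l) = segment x (n + k) (l - k).
Proof.
by move=> kl; rewrite -{1}(subnKC kl) segmentD drop_size_cat // size_segment.
Qed.

Definition ray_path x n k : L := lpa_path K (segment x n k) (src (x (n + k)%N)).
Definition ray_ghost x n k : L := lpa_ghost K (segment x n k) (src (x (n + k)%N)).

Lemma ray_pathD x n k l :
  ray_path x n (k + l) = ray_path x n k ** ray_path x (n + k) l.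
Proof. by rewrite /ray_path lpa_path_cat walk_segment segmentD addnA. Qed.

Lemma ray_ghostD x n k l :
  ray_ghost x n (k + l) = ray_ghost x (n + k) l ** ray_ghost x n k.
Proof. by rewrite /ray_ghost lpa_ghost_cat walk_segment segmentD addnA. Qed.

Lemma ray_vpath x n k : lpa_v K (src (x n)) ** ray_path x n k = ray_path x n k.
Proof. by rewrite lpa_vpath walk_segment. Qed.

Lemma ray_ghostv x n k : ray_ghost x n k ** lpa_v K (src (x n)) = ray_ghost x n k.
Proof. by rewrite lpa_ghostv walk_segment. Qed.

Lemma ray_ghost_path x n k :
  ray_ghost x n k ** ray_path x n k = lpa_v K (src (x (n + k)%N)).
Proof.
rewrite (lpa_ghost_path_long _ _ (walk_segment x n k)) //.
by rewrite take_size eqxx drop_size /= lpa_vid.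
Qed.

Lemma lpa_path_eq0 p w : ~ (exists v, walk v p w) -> lpa_path K p w = 0.
Proof.
case: p => [|e p] nw; first by case: nw; exists w => /=.
have := lpa_vpath K (src e) (e :: p) w.
case: ifP => [ww|_]; first by case: nw; exists (src e).
by rewrite /= numulA lpa_ve eqxx.
Qed.

Lemma lpa_ghost_eq0 p w : ~ (exists v, walk v p w) -> lpa_ghost K p w = 0.
Proof.
case: p => [|e p] nw; first by case: nw; exists w => /=.
have := lpa_ghostv K (src e) (e :: p) w.
case: ifP => [ww|_]; first by case: nw; exists (src e).
by rewrite /= -numulA lpa_gv eqxx.
Qed.

(** The algebraic form of being supported on [x]: the projection belonging to each initial segment
    of [x] fixes [m]. *)
Definition on_ray M x (m : M) :=
  forall n, nuact (ray_path x 0 n ** ray_ghost x 0 n) m = m.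

Section OnRay.
Variables (M : nonUnitalLmodType L) (x : ray) (m : M).
Hypothesis xm : on_ray x m.

Lemma on_ray_v : nuact (lpa_v K (src (x 0%N))) m = m.
Proof. by have := xm 0; rewrite /ray_path /ray_ghost /= lpa_vid. Qed.

Lemma on_ray_shift n k :
  nuact (ray_path x n k) (nuact (ray_ghost x n k) (nuact (ray_ghost x 0 n) m)) =
  nuact (ray_ghost x 0 n) m.
Proof.
have gD := ray_ghostD x 0 n k; have pD := ray_pathD x 0 n k.
rewrite add0n in gD pD.
rewrite [nuact (ray_ghost x n k) _]nuactA -gD -{2}(xm (n + k)) pD.
by rewrite [RHS]nuactA !numulA ray_ghost_path add0n ray_vpath -nuactA.
Qed.

(** Replace [m] by its image under the projection of length [N]. Once [N] exceeds the length of
    every ghost part of [a], each ghost part either cancels against the initial segment of [x] or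
    gives 0, and only genuine paths ending on [x] remain. *)
Lemma on_ray_expand a : exists N0, forall N, (N0 <= N)%N ->
  exists s : seq (K * seq (edge E)),
    (forall i, i \in s -> exists v, walk v i.2 (src (x N))) /\
    nuact a m = \sum_(i <- s)
      nuact (i.1 *: lpa_path K i.2 (src (x N))) (nuact (ray_ghost x 0 N) m).
Proof.
elim: (lpa_spannedP a) => [|b c _ [Nb IHb] _ [Nc IHc]|k w p q].
- by exists 0 => N _; exists [::]; rewrite big_nil nuact0l.
- exists (maxn Nb Nc) => N; rewrite geq_max => /andP[/IHb[s [sw sE]] /IHc[t [tw tE]]].
  exists (s ++ t); split; last by rewrite big_cat nuactDl sE tE.
  by move=> i; rewrite mem_cat => /orP[/sw|/tw].
- exists (size q) => N qN.
  suff [d dE] : exists d, lpa_path K p w ** (lpa_ghost K q w ** ray_path x 0 N) =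
      lpa_path K d (src (x N)) \/
      lpa_path K p w ** (lpa_ghost K q w ** ray_path x 0 N) = 0.
    rewrite -{1}(xm N) nuactA -!nuscalerAl !numulA -!(numulA (lpa_path K p w)).
    rewrite numulA.
    have [dw|dw] := pselect (exists v, walk v d (src (x N))).
      case: dE => ->; last first.
        by exists [::]; rewrite big_nil numul0r scaler0 nuact0l.
      exists [:: (k, d)]; rewrite big_seq1; split; last by rewrite nuactA -nuscalerAl.
      by move=> i; rewrite inE => /eqP->.
    exists [::]; rewrite big_nil; split=> //.
    by case: dE => ->; rewrite ?(lpa_path_eq0 dw) numul0r scaler0 nuact0l.
  have [[v qw]|qw] := pselect (exists v, walk v q w); last first.
    by exists [::]; right; rewrite (lpa_ghost_eq0 qw) numul0r numulr0.
  exists (p ++ drop (size q) (segment x 0 N)).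
  rewrite (lpa_ghost_path_long _ _ qw) ?size_segment //.
  case: ifP => _; last by right; rewrite numulr0.
  rewrite lpa_vpath; case: ifP => wd; last by right; rewrite numulr0.
  by left; rewrite lpa_path_cat wd.
Qed.

End OnRay.

(** Pull the expansion of [n = a m] back along the first [l] edges of [y]: a term survives only if
    its path is an initial segment of [y]. *)
Lemma on_ray_compare M x y (m n : M) a : on_ray x m -> on_ray y n ->
  nuact a m = n -> exists N0, forall N, (N0 <= N)%N ->
  exists (s : seq (K * seq (edge E))) l0,
    (forall i, i \in s -> exists v, walk v i.2 (src (x N))) /\
    forall l, (l0 <= l)%N ->
    (forall i, i \in s -> (size i.2 <= l)%N) /\
    nuact (ray_ghost y 0 l) n =
      \sum_(i <- s | segment y 0 (size i.2) == i.2)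
        nuact (i.1 *: (ray_ghost y (size i.2) (l - size i.2) **
                       lpa_v K (src (x N))))
              (nuact (ray_ghost x 0 N) m).
Proof.
move=> xm yn amn; have [N0 N0P] := on_ray_expand xm a.
exists N0 => N /N0P[s [sw sE]]; exists s.
exists (\max_(i <- s) size i.2)%N; split=> // l lP.
have sl i : i \in s -> (size i.2 <= l)%N.
  by move=> si; apply: leq_trans lP;
    apply: (@leq_bigmax_seq _ _ xpredT (fun i : K * seq (edge E) => size i.2)).
split=> //; rewrite -amn sE nuact_sumr [RHS]big_mkcond big_seq [RHS]big_seq.
apply: eq_bigr => i si; have [v iv] := sw i si.
rewrite nuactA -nuscalerAr (lpa_ghost_path_short _ _ iv) ?size_segment ?sl //.
rewrite take_segment ?sl // drop_segment ?sl // add0n.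
case: ifP => _; last by rewrite scaler0 nuact0l.
by rewrite /ray_ghost subnKC ?sl.
Qed.

(** In a surviving term, the rest of [y] up to its edge [k] is pulled back from a vector supported
    on a tail of [x]. If [y k] is not an edge of [x], the two segments differ, all terms vanish, and
    [n = 0]. *)
Lemma on_ray_meet M x y (m n : M) : simple_module M ->
  m <> 0 -> n <> 0 -> on_ray x m -> on_ray y n ->
  exists k0, forall k, (k0 <= k)%N -> exists j, y k = x j.
Proof.
move=> sM m0 n0 xm yn; have [a amn] := simple_gen sM n m0.
have [N /(_ N (leqnn N))[s [l0 [sw sP]]]] := on_ray_compare xm yn amn.
exists l0 => k lk; have [sl sE] := sP k.+1 (leqW lk); have [sk _] := sP k lk.
apply: contrapT => ny; apply: n0; rewrite -(yn k.+1) -nuactA sE.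
rewrite big_seq_cond big1 ?nuact0r // => i /andP[si _].
rewrite -(on_ray_shift xm N (k.+1 - size i.2)) [LHS]nuactA.
rewrite -nuscalerAl -numulA ray_vpath.
rewrite (lpa_ghost_path_short _ _ (walk_segment x N _)) ?size_segment //.
rewrite take_segment //; case: eqP => [sxy|_]; last by rewrite scaler0 nuact0l.
case: ny; exists (N + (k - size i.2))%N.
have := congr1 (fun t => nth (y k) t (k - size i.2)) sxy; rewrite subSn ?sk //.
rewrite !(nth_map 0%N) ?size_iota ?subSn ?sk // !nth_iota ?subSn ?sk //.
by rewrite subnKC ?sk.
Qed.

Section RayModel.
Variable x : ray.
Let H := (set0 : set (vertex E)).

Let x_out n : ~ H (src (x n)). Proof. by []. Qed.
Let hH : hereditary H. Proof. exact: hereditary0. Qed.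

Lemma act_ray_path n k phi :
  lpa_act H (ray_path x n k) (tail_fun x (n + k) phi) =
  tail_fun x n (fun i => phi (i - k%:Z)).
Proof.
elim: k n phi => [|k IH] n phi.
  rewrite addn0 /ray_path /= addn0 (act_v_tail hH (rayP x) x_out).
  by congr tail_fun; apply/funext => i; rewrite subr0.
rewrite /ray_path addnS -addSn /= (lpa_actM hH) -[lpa_path _ _ _]/(ray_path x n.+1 k).
rewrite IH (act_e_tail hH (rayP x) x_out).
by congr tail_fun; apply/funext => i; congr phi; lia.
Qed.

Lemma act_ray_ghost n k phi :
  lpa_act H (ray_ghost x n k) (tail_fun x n phi) =
  tail_fun x (n + k) (fun i => phi (i + k%:Z)).
Proof.
elim: k n phi => [|k IH] n phi.
  rewrite addn0 /ray_ghost /= addn0 (act_v_tail hH (rayP x) x_out).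
  by congr tail_fun; apply/funext => i; rewrite addr0.
rewrite /ray_ghost addnS -addSn /= (lpa_actM hH) -[lpa_ghost _ _ _]/(ray_ghost x n.+1 k).
rewrite (act_g_tail hH (rayP x) x_out) IH.
by congr tail_fun; apply/funext => i; congr phi; lia.
Qed.

(** The projections of the initial segments of [x] fix [tail_fun x 0 phi], and every relation
    satisfied by this function passes to [m]. *)
Lemma exists_simple_on_ray phi i0 : phi i0 <> 0 ->
  exists (M : nonUnitalLmodType L) (m : M), [/\ simple_module M, m <> 0,
    on_ray x m &
    forall a, lpa_act H a (tail_fun x 0 phi) = (fun=> 0) -> nuact a m = 0].
Proof.
move=> phi0.
have [|M [sM [m [m0 vm mI]]]] := simple_of_path_function hH
    (act_v_tail hH (rayP x) x_out 0 phi).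
  move/(congr1 (fun g => g ((fun k => inr (x k)), i0))).
  by rewrite /tail_fun /=; case: asboolP.
exists M, m; split=> // n; apply/eqP; rewrite -subr_eq0 -{2}vm -nuactBl.
apply/eqP/mI/funext => z; rewrite (lpa_actB hH) (lpa_actM hH).
rewrite act_ray_ghost -[X in tail_fun x X]/(0 + n)%N act_ray_path (act_v_tail hH (rayP x) x_out).
have -> : (fun i => phi (i - n%:Z + n%:Z)) = phi by apply/funext => i; rewrite subrK.
by rewrite subrr.
Qed.

End RayModel.

End Rays.

(** * Cycles *)

Section FiniteType.
Variable R : nonUnitalRingType.

(** Pigeonhole for invariants of simple modules: every value in [A] is attained and a simple module
    has at most one. It is applied to primes attached to a cycle and to breaking vertices. *)
Lemma frt_relation (T : choiceType) (A : set T)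
    (r : nonUnitalLmodType R -> T -> Prop) :
  finite_irreducible_representation_type R ->
  (forall t, A t -> exists2 M, simple_module M & r M t) ->
  (forall (M N : nonUnitalLmodType R) t, module_iso M N -> r M t -> r N t) ->
  (forall M t t', simple_module M -> A t -> A t' -> r M t -> r M t' -> t = t') ->
  finite_set A.
Proof.
move=> [n [S [sS allS]]] ex iso_r inj_r.
apply: (@finite_set_of_relation 'I_n _ _ (fun i => r (S i))) => [t /ex[M sM rM]|].
  by have [i Mi] := allS M sM; exists i; apply: iso_r rM.
by move=> i t t'; apply: inj_r.
Qed.

End FiniteType.

Section Cycle.
Variables (K : fieldType) (E : digraph).
Local Notation L := (leavitt_path_algebra K E).
Local Notation "a ** b" := (numul a b) (at level 40, left associativity).
Variable x : ray E.
Variable l : nat.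
Hypothesis l_gt0 : (0 < l)%N.
Hypothesis x_per : forall n, x (n + l)%N = x n.
Hypothesis x_src : forall n, src (x n) = src (x 0%N) -> (l %| n)%N.

Let v := src (x 0%N).

Lemma cycle_period n j : x (j * l + n)%N = x n.
Proof. by elim: j => [|j IH] //; rewrite mulSn -addnA addnC x_per. Qed.

Lemma cycle_src j : src (x (j * l)%N) = v.
Proof. by rewrite -[X in x X]addn0 cycle_period. Qed.

Lemma cycle_segment j k : segment x (j * l) k = segment x 0 k.
Proof.
rewrite /segment -[X in iota X]addn0 iotaDl -map_comp.
by apply: eq_map => i /=; exact: cycle_period.
Qed.

Definition cycle_pow j : L := ray_path K x 0 (j * l).
Definition cycle_gpow j : L := ray_ghost K x 0 (j * l).

Lemma cycle_powE j : cycle_pow j = lpa_path K (segment x 0 (j * l)) v.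
Proof. by rewrite /cycle_pow /ray_path add0n cycle_src. Qed.

Lemma cycle_gpowE j : cycle_gpow j = lpa_ghost K (segment x 0 (j * l)) v.
Proof. by rewrite /cycle_gpow /ray_ghost add0n cycle_src. Qed.

Lemma cycle_powD i j : cycle_pow (i + j) = cycle_pow i ** cycle_pow j.
Proof.
rewrite /cycle_pow mulnDl ray_pathD add0n; congr numul.
by rewrite /ray_path cycle_segment -mulnDl cycle_src add0n cycle_src.
Qed.

Lemma cycle_gpowK j : cycle_gpow j ** cycle_pow j = lpa_v K v.
Proof. by rewrite ray_ghost_path add0n cycle_src. Qed.

Definition cycle_sum p : L := \sum_(i < p) cycle_pow i.

Lemma cycle_sum_comm p j : cycle_sum p ** cycle_pow j = cycle_pow j ** cycle_sum p.
Proof.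
rewrite numul_suml numul_sumr; apply: eq_bigr => i _.
by rewrite -!cycle_powD addnC.
Qed.

Lemma cycle_sumv p : cycle_sum p ** lpa_v K v = cycle_sum p.
Proof.
rewrite numul_suml; apply: eq_bigr => i _.
by rewrite cycle_powE lpa_pathv eqxx.
Qed.

Section Module.
Variable M : nonUnitalLmodType L.
Implicit Types m n : M.

Lemma cycle_pow0 m : on_ray x m -> nuact (cycle_pow 0) m = m.
Proof. by move=> xm; rewrite cycle_powE mul0n; exact: on_ray_v. Qed.

(** This is (1 - c)(1 + ... + c^(p-1)) = 1 - c^p, obtained by splitting the sum of [p.+1] powers at
    its last and at its first term. *)
Lemma cycle_pow_id p m : on_ray x m -> nuact (cycle_sum p) m = 0 ->
  forall j, nuact (cycle_pow (j * p)) m = m.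
Proof.
move=> xm pm; have p1 : nuact (cycle_pow p) m = m.
  have : nuact (cycle_sum p.+1) m = nuact (cycle_pow p) m.
    by rewrite /cycle_sum big_ord_recr nuactDl -/(cycle_sum p) pm add0r.
  rewrite /cycle_sum big_ord_recl nuactDl cycle_pow0 // => <-.
  rewrite (_ : nuact _ m = 0) ?addr0 //.
  rewrite -(nuact0r M (cycle_pow 1)) -pm nuactA numul_sumr.
  by congr (nuact _ m); apply: eq_bigr => i _; rewrite -cycle_powD.
elim=> [|j IH]; first exact: cycle_pow0.
by rewrite mulSn cycle_powD -nuactA IH.
Qed.

(** Since c^p fixes [m], one may write [m] as c^(jp) m, in which the ghost power cancels [j] of the
    factors. *)
Lemma cycle_gpow_act p m j : on_ray x m -> nuact (cycle_sum p) m = 0 ->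
  (0 < p)%N -> exists i, nuact (cycle_gpow j) m = nuact (cycle_pow i) m.
Proof.
move=> xm pm p0; exists (j * p - j)%N.
rewrite -{1}(cycle_pow_id xm pm j) -{1}(subnKC (leq_pmulr j p0)) cycle_powD.
by rewrite nuactA numulA cycle_gpowK ray_vpath.
Qed.

Lemma cycle_gpow_id p m : on_ray x m -> nuact (cycle_sum p) m = 0 ->
  forall j, nuact (cycle_gpow (j * p)) m = m.
Proof.
move=> xm pm j; rewrite -{1}(cycle_pow_id xm pm j) nuactA cycle_gpowK.
exact: on_ray_v.
Qed.

(* Expanding n = a m and pulling n back along a high power of the cycle leaves
   only powers of the cycle, so that n lies in K[c] m. *)
Lemma cycle_sum_transfer p q m n : simple_module M -> m <> 0 ->
  (0 < p)%N -> (0 < q)%N ->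
  on_ray x m -> on_ray x n ->
  nuact (cycle_sum p) m = 0 -> nuact (cycle_sum q) n = 0 ->
  nuact (cycle_sum p) n = 0.
Proof.
move=> sM m0 p0 q0 xm xn pm qn; have [a amn] := simple_gen sM n m0.
have [N0 N0P] := on_ray_compare xm xn amn.
(* The lengths [N0 * p * l] and, below, [l0 * q * l] are large enough, and the ghost powers of these
   lengths fix [m] and [n] respectively. *)
have N0N : (N0 <= N0 * p * l)%N by rewrite -mulnA leq_pmulr // muln_gt0 p0.
have [s [l0 [sw sP]]] := N0P _ N0N; rewrite cycle_src in sw sP.
have l0l : (l0 <= l0 * q * l)%N by rewrite -mulnA leq_pmulr // muln_gt0 q0.
have [sl] := sP _ l0l.
rewrite -!/(cycle_gpow _) !(cycle_gpow_id xm pm, cycle_gpow_id xn qn) => ->.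
rewrite nuact_sumr big_seq_cond big1 // => i /andP[si /eqP iE].
have [u iw] := sw i si.
(* A surviving path is an initial segment of [x] ending at the base [v], hence a power of the
   cycle. *)
have srci : src (x (size i.2)) = v.
  have u0 : walk u (segment x 0 (size i.2)) v by rewrite iE.
  have := walk_segment x 0 (size i.2); rewrite add0n.
  case: (size i.2) u0 => [|k] //= /andP[/eqP ux vw] /andP[_].
  by move=> /walk_inj; exact.
have /dvdnP[j jE] := x_src srci.
have -> : ray_ghost K x (size i.2) (l0 * q * l - size i.2) =
    cycle_gpow (l0 * q - j).
  rewrite /ray_ghost (subnKC (sl _ si)) cycle_src jE cycle_segment -mulnBl.
  by rewrite cycle_gpowE.
have -> : cycle_gpow (l0 * q - j) ** lpa_v K v = cycle_gpow (l0 * q - j).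
  by rewrite ray_ghostv.
have [t tE] := cycle_gpow_act (l0 * q - j) xm pm p0.
have -> : i.1 *: cycle_gpow (l0 * q - j) =
    (i.1 *: lpa_v K v) ** cycle_gpow (l0 * q - j).
  by rewrite -nuscalerAl cycle_gpowE lpa_vghost eqxx.
rewrite -nuactA tE !nuactA -nuscalerAr cycle_sumv -nuscalerAl.
rewrite cycle_sum_comm nuscalerAl.
by rewrite -nuactA pm nuact0r.
Qed.

(** By [cycle_sum_transfer] both sums kill [n], so c^p and c^q fix [n], and then so does c by
    Bezout. The sums therefore act on [n] as the integers [p] and [q], whose coprimality forces
    [n = 0]. *)
Lemma cycle_sum_coprime p q m n : simple_module M -> m <> 0 -> n <> 0 ->
  (0 < p)%N -> (0 < q)%N -> coprime p q ->
  on_ray x m -> on_ray x n ->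
  nuact (cycle_sum p) m = 0 -> nuact (cycle_sum q) n = 0 -> False.
Proof.
move=> sM m0 n0 p0 q0 pq xm xn pm qn.
have pn := cycle_sum_transfer sM m0 p0 q0 xm xn pm qn.
have [u w uw _] := egcdnP q p0; rewrite (eqP (pq : gcdn p q == 1)) in uw.
have c1 : nuact (cycle_pow 1) n = n.
  by rewrite -[RHS](cycle_pow_id xn pn u) uw addnC cycle_powD -nuactA
    (cycle_pow_id xn qn).
have cE i : nuact (cycle_pow i) n = n.
  elim: i => [|i IH]; first exact: cycle_pow0.
  by rewrite -addn1 cycle_powD -nuactA c1 IH.
have sumE i : nuact (cycle_sum i) n = n *+ i.
  rewrite nuact_suml (eq_bigr (fun=> n)) => [|j _]; last exact: cE.
  by rewrite sumr_const card_ord.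
apply: n0; have : n *+ (u * p) = n *+ (w * q + 1) by rewrite uw.
by rewrite mulrnDr mulnC [(w * q)%N]mulnC !mulrnA -(sumE p) -(sumE q) pn qn !mul0rn add0r mulr1n => <-.
Qed.

End Module.

Lemma exists_simple_cycle_sum p : (1 < p)%N ->
  exists (M : nonUnitalLmodType L) (m : M), [/\ simple_module M, m <> 0,
    on_ray x m & nuact (cycle_sum p) m = 0].
Proof.
move=> p1.
(* The sum of the translates of [phi] by the multiples j l with [j < p] telescopes to d(i) - d(i - p
   l), which is 0 as [d] has period p l. Moreover [phi 0] is 1, because p l does not divide l when
   [p > 1]. *)
pose d (i : int) : K := ((p * l)%:Z %| i)%Z%:R.
pose phi i := d i - d (i - l%:Z).
have phi0 : phi 0 <> 0.
  rewrite /phi /d dvdz0 sub0r rpredN dvdzE /= gtnNdvd ?subr0 //.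
    by apply/eqP; exact: oner_neq0.
  by rewrite ltn_Pmull.
have [M [m [sM m0 xm mI]]] := exists_simple_on_ray x phi0.
exists M, m; split=> //; apply: mI; apply/funext => z.
rewrite lpa_act_sum /=; last exact: hereditary0.
have xj j : tail_fun x (j * l) phi = tail_fun x 0 phi.
  rewrite /tail_fun (_ : (fun k => inr (x (j * l + k)%N)) = fun k => inr (x k)) //.
  by apply/funext => k; rewrite cycle_period.
have actE j : lpa_act set0 (cycle_pow j) (tail_fun x 0 phi) =
    tail_fun x 0 (fun i => phi (i - (j * l)%:Z)).
  by rewrite -(xj j) /cycle_pow -[X in tail_fun x X]add0n act_ray_path.
under eq_bigr do rewrite actE.
transitivity (tail_fun x 0 (fun i => \sum_(0 <= j < p) phi (i - (j * l)%:Z)) z).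
  by rewrite /tail_fun; case: ifP => _; [rewrite big_mkord|rewrite big1].
rewrite /tail_fun; case: ifP => // _.
rewrite (eq_bigr (fun j => - (d (z.2 - (j.+1 * l)%:Z) - d (z.2 - (j * l)%:Z)))).
  rewrite sumrN telescope_sumr // mul0n subr0 /d.
  have -> : ((p * l)%:Z %| z.2 - (p * l)%:Z)%Z = ((p * l)%:Z %| z.2)%Z.
    by apply: rpredBr; exact: dvdzz.
  by rewrite subrr oppr0.
move=> j _; rewrite opprB /phi; congr (d _ - d _); lia.
Qed.

End Cycle.

(** * Acyclicity from the infinitude of primes *)

Section Acyclic.
Variables (K : fieldType) (E : digraph).
Local Notation L := (leavitt_path_algebra K E).

Lemma primes_infinite : ~ finite_set [set p | prime p].
Proof.
move=> fin; have [p pN pp] := prime_above (\max_(q <- fset_set [set p | prime p]) q).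
have : p \in fset_set [set p | prime p] by rewrite in_fset_set // inE.
move=> /(@leq_bigmax_seq _ _ xpredT (fun q : nat => q)) /(_ isT).
by rewrite leqNgt pN.
Qed.

Lemma frt_acyclic : finite_irreducible_representation_type L -> acyclic E.
Proof.
move=> frt e p [[ep pe] uniq_ep].
pose l := size (e :: p).
pose y n := nth e (e :: p) (n %% l)%N.
have y_path n : rng (y n) = src (y n.+1).
  rewrite /y; have := ltn_pmod n (ltn0Sn (size p)); rewrite -/l => nl.
  have [nl1|nl1] := ltnP (n %% l).+1 l.
    rewrite -[n.+1]addn1 -modnDml addn1 (modn_small nl1) /=.
    by move/(pathP e): ep => /(_ (n %% l)%N) /(_ nl1)/eqP.
  have nlE : (n %% l = size p)%N by apply/eqP; rewrite eqn_leq -ltnS nl -ltnS nl1.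
  rewrite -[n.+1]addn1 -modnDml nlE addn1 modnn /= -pe.
  by rewrite (last_nth e).
pose x : ray E := exist _ y y_path.
have x_per n : x (n + l)%N = x n by rewrite /x /= /y modnDr.
have x_src n : src (x n) = src (x 0%N) -> (l %| n)%N.
  rewrite /x /= /y mod0n => /eqP; rewrite -!(nth_map _ (src e)) ?ltn_pmod //.
  rewrite nth_uniq ?size_map ?ltn_pmod //.
have l0 : (0 < l)%N by [].
apply: primes_infinite.
apply: (frt_relation (r := fun M p => exists m : M,
  [/\ m <> 0, on_ray x m & nuact (cycle_sum K x l p) m = 0]) frt) => [q|M N q|M q q'].
- move=> /prime_gt1 q1.
  have [M [m [sM m0 xm qm]]] := exists_simple_cycle_sum K l0 x_per q1.
  by exists M => //; exists m.
- move=> [f [bf fA]] [m [m0 xm qm]]; exists (f m); split.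
  + by move=> fm0; apply: m0; apply: (bij_inj bf); rewrite raddf0.
  + by move=> n; rewrite -fA xm.
  + by rewrite -fA qm raddf0.
- move=> sM pq pq' [m [m0 xm qm]] [n [n0 xn q'n]].
  have [//|qq'] := eqVneq q q'; exfalso.
  apply: (cycle_sum_coprime l0 x_per x_src sM m0 n0 _ _ _ xm xn qm q'n).
  + exact: prime_gt0.
  + exact: prime_gt0.
  + by rewrite prime_coprime // dvdn_prime2.
Qed.

End Acyclic.

(** * Hereditary saturated sets and breaking vertices *)

Section Vanishing.
Variables (K : fieldType) (E : digraph).
Local Notation L := (leavitt_path_algebra K E).
Implicit Types (u v w : vertex E) (e f : edge E) (p q : seq (edge E)).
Implicit Types (a b : L) (M N : nonUnitalLmodType L) (H : set (vertex E)).
Local Notation "a ** b" := (numul a b) (at level 40, left associativity).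

Definition vanishing M : set (vertex E) :=
  [set v | forall m : M, nuact (lpa_v K v) m = 0].

Lemma vanishing_hereditary M : hereditary (vanishing M).
Proof.
apply/hereditary_edgeP => e se m.
have <- : lpa_g K e ** (lpa_v K (src e) ** lpa_e K e) = lpa_v K (rng e).
  by rewrite lpa_ve eqxx lpa_ge eqxx.
by rewrite -!nuactA se nuact0r.
Qed.

Lemma vanishing_e M e (m : M) : vanishing M (rng e) -> nuact (lpa_e K e) m = 0.
Proof. by move=> ve; rewrite -lpa_eK -nuactA ve nuact0r. Qed.

Lemma vanishing_saturated M : saturated (vanishing M).
Proof.
move=> v rv sv m; rewrite lpa_vsum // nuact_suml big_seq big1 // => e.
rewrite in_fset_set ?inE; last by case: rv.
by move=> ev; rewrite -nuactA vanishing_e //; apply: sv; exists e.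
Qed.

Lemma vanishing_iso M N : module_iso M N -> vanishing M = vanishing N.
Proof.
move=> [f [[g fK gK] fA]]; apply/seteqP; split=> v vM m.
  by rewrite -[m]gK -fA vM raddf0.
by apply: (can_inj fK); rewrite fA vM raddf0.
Qed.

Lemma simple_vanishing M (m : M) H : simple_module M -> m <> 0 ->
  (forall v a, H v -> nuact (lpa_v K v ** a) m = 0) -> H `<=` vanishing M.
Proof.
move=> sM m0 Hm v Hv n; have [a <-] := simple_gen sM n m0.
by rewrite nuactA Hm.
Qed.

Lemma simple_vanishingT M : simple_module M -> vanishing M <> setT.
Proof.
move=> [[a [m am]] _] vT; apply: am.
elim: (lpa_spannedP a) => [|b c _ IHb _ IHc|k w p q]; first exact: nuact0l.
  by rewrite nuactDl IHb IHc addr0.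
rewrite nuscalerAr -nuactA; set n := nuact _ m.
have {}vT v (n' : M) : nuact (lpa_v K v) n' = 0.
  by move: n'; change (vanishing M v); rewrite vT.
case: p => [|e p] /=; first exact: vT.
have := lpa_ve K (src e) e; rewrite eqxx => <-.
by rewrite -!numulA -nuactA vT.
Qed.

(** The module carries no scalar action of its own, so scalars act only through multiples [k *: a].
    If [k] is invertible, a a = (k^-1 a)(k a) recovers [m] from (k a) m. *)
Lemma nuactZ_eq0 M a (m : M) (k : K) : nuact a m = m -> m <> 0 ->
  nuact (k *: a) m = 0 <-> k = 0.
Proof.
move=> am m0; split=> [km|->]; last by rewrite scale0r nuact0l.
apply: contrapT => /eqP k0; apply: m0.
rewrite -{1}am -{1}am nuactA -[_ ** _]scale1r -(mulVf k0) -scalerA.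
by rewrite nuscalerAr nuscalerAl -nuactA km nuact0r.
Qed.

Definition quot_edges H w := out_edges w `&` @rng E @^-1` (~` H).

(** For [w] in B_H this is the idempotent usually written w^H. It measures what relation (4) misses
    at [w] modulo [H]. *)
Definition lpa_gap H w : L :=
  lpa_v K w - \sum_(e <- fset_set (quot_edges H w)) lpa_e K e ** lpa_g K e.

(** On an infinite set [fset_set] defaults to the empty set, where the implication is vacuous. *)
Lemma fset_set_mem (T : choiceType) (A : set T) t : t \in fset_set A -> A t.
Proof.
rewrite /fset_set; case: pselect => // fA; rewrite -/(fset_set A).
by case: cid => B /= AB tB; have : [set` B] t by []; rewrite -AB.
Qed.

Lemma lpa_gap_v H w u : lpa_gap H w ** lpa_v K u = if u == w then lpa_gap H w else 0.
Proof.
rewrite numulBl lpa_vv [w == u]eq_sym; case: eqP => [->|uw].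
  congr (_ - _); rewrite numul_suml big_seq [RHS]big_seq; apply: eq_bigr => e.
  by move=> /fset_set_mem[we _]; rewrite -numulA lpa_gv we eqxx.
rewrite sub0r numul_suml big_seq big1 ?oppr0 // => e /fset_set_mem[we _].
by rewrite -numulA lpa_gv we; case: eqP => [/esym//|]; rewrite numulr0.
Qed.

Lemma lpa_v_gap H w u : lpa_v K u ** lpa_gap H w = if u == w then lpa_gap H w else 0.
Proof.
rewrite numulBr lpa_vv; case: eqP => [->|uw].
  congr (_ - _); rewrite numul_sumr big_seq [RHS]big_seq; apply: eq_bigr => e.
  by move=> /fset_set_mem[we _]; rewrite numulA lpa_ve we eqxx.
rewrite sub0r numul_sumr big_seq big1 ?oppr0 // => e /fset_set_mem[we _].
by rewrite numulA lpa_ve we; case: eqP => [/esym//|]; rewrite numul0r.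
Qed.

Lemma quot_edges_sum_e H w e : finite_set (quot_edges H w) ->
  (\sum_(f <- fset_set (quot_edges H w)) lpa_e K f ** lpa_g K f) ** lpa_e K e =
  if `[< quot_edges H w e >] then lpa_e K e else 0.
Proof.
move=> fw; rewrite numul_suml; case: asboolP => [we|nwe].
  rewrite (bigD1_seq e) ?fset_uniq //=; last by rewrite in_fset_set // inE.
  rewrite -numulA lpa_ge eqxx lpa_eK big1 ?addr0 // => f /negPf fe.
  by rewrite -numulA lpa_ge fe numulr0.
rewrite big_seq big1 // => f /fset_set_mem wf; rewrite -numulA lpa_ge.
by case: eqP => [fe|]; rewrite ?numulr0 //; case: nwe; rewrite -fe.
Qed.

Lemma quot_edges_sum_g H w e : finite_set (quot_edges H w) ->
  lpa_g K e ** (\sum_(f <- fset_set (quot_edges H w)) lpa_e K f ** lpa_g K f) =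
  if `[< quot_edges H w e >] then lpa_g K e else 0.
Proof.
move=> fw; rewrite numul_sumr; case: asboolP => [we|nwe].
  rewrite (bigD1_seq e) ?fset_uniq //=; last by rewrite in_fset_set // inE.
  rewrite numulA lpa_ge eqxx lpa_gK big1 ?addr0 // => f /negPf fe.
  by rewrite numulA lpa_ge [e == f]eq_sym fe numul0r.
rewrite big_seq big1 // => f /fset_set_mem wf; rewrite numulA lpa_ge.
by case: eqP => [fe|]; rewrite ?numul0r //; case: nwe; rewrite fe.
Qed.

Lemma lpa_gap_idem H w : finite_set (quot_edges H w) ->
  lpa_gap H w ** lpa_gap H w = lpa_gap H w.
Proof.
move=> fw; rewrite {2}/lpa_gap numulBr lpa_gap_v eqxx numul_sumr.
rewrite big_seq big1 ?subr0 // => e /fset_set_mem we.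
rewrite numulA numulBl quot_edges_sum_e // lpa_ve.
case: (we) => [-> _]; rewrite eqxx; case: asboolP => // _.
by rewrite subrr numul0r.
Qed.

Section Gap.
Variables (H : set (vertex E)) (M : nonUnitalLmodType L).
Hypothesis HM : H `<=` vanishing M.

(** An edge into [H] acts as zero, an edge of [w] leaving [H] alone is cancelled by the sum in the
    gap, and any other edge does not start at [w]. *)
Lemma gap_e w e (m : M) : finite_set (quot_edges H w) ->
  nuact (lpa_gap H w) (nuact (lpa_e K e) m) = 0.
Proof.
move=> fw; have [He|nHe] := pselect (H (rng e)).
  by rewrite vanishing_e ?nuact0r //; exact: HM.
rewrite nuactA numulBl quot_edges_sum_e // lpa_ve.
case: eqP => we; case: asboolP => ewe; rewrite ?subrr ?nuact0l //.
  by case: ewe; split.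
by case: ewe => /we.
Qed.

Lemma g_gap w e (m : M) : finite_set (quot_edges H w) ->
  nuact (lpa_g K e) (nuact (lpa_gap H w) m) = 0.
Proof.
move=> fw; have [He|nHe] := pselect (H (rng e)).
  by rewrite -lpa_gK -nuactA; apply: HM.
rewrite nuactA numulBr quot_edges_sum_g // lpa_gv.
case: eqP => we; case: asboolP => ewe; rewrite ?subrr ?nuact0l //.
  by case: ewe; split.
by case: ewe => /we.
Qed.

End Gap.

Lemma gap_v_id H w M (m : M) :
  nuact (lpa_gap H w) m = m -> nuact (lpa_v K w) m = m.
Proof. by move=> wm; rewrite -wm nuactA lpa_v_gap eqxx. Qed.

(** By [gap_e] and [g_gap], monomials containing an edge or a ghost edge contribute nothing, and
    only multiples of vertices remain. The scalar is chosen before the module, which is what allows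
    two modules to be compared. *)
Lemma gap_corner H w w' a :
  finite_set (quot_edges H w) -> finite_set (quot_edges H w') ->
  exists k : K, forall M (m : M), H `<=` vanishing M ->
    nuact (lpa_gap H w) m = m ->
    nuact (lpa_gap H w') (nuact a m) = nuact (k *: lpa_gap H w') m.
Proof.
move=> fw fw'; elim: (lpa_spannedP a) => [|b c _ [k kP] _ [l lP]|k u p q].
- by exists 0 => M m _ _; rewrite scale0r !nuact0l nuact0r.
- exists (k + l) => M m HM wm.
  by rewrite [nuact (b + c) m]nuactDl nuactDr kP // lP // scalerDl [RHS]nuactDl.
- case: q => [|f q]; last first.
    exists 0 => M m HM wm; rewrite scale0r nuact0l nuscalerAr /= nuscalerAl.
    by rewrite -!nuactA -wm (g_gap HM) // !nuact0r.
  case: p => [|e p]; last first.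
    exists 0 => M m HM wm; rewrite scale0r nuact0l /= -numulA nuscalerAr -[nuact (_ ** _) m]nuactA.
    by rewrite (gap_e HM).
  have [->|uw] := eqVneq u w.
    exists k => M m HM wm; rewrite /= lpa_vid nuactA -nuscalerAr.
    by rewrite nuscalerAl -nuactA (gap_v_id wm).
  exists 0 => M m HM wm; rewrite scale0r nuact0l /= lpa_vid.
  rewrite -wm [X in nuact _ X]nuactA -nuscalerAl lpa_v_gap (negPf uw).
  by rewrite scaler0 nuact0l nuact0r.
Qed.

(** For [w] and [w'] distinct, the scalar of [gap_corner] multiplies the gap of [w'] applied to
    [m = w m], which is 0. Hence a simple module annihilated by [H] sees at most one gap. *)
Lemma gap_orthogonal H w w' M (m n : M) : simple_module M ->
  H `<=` vanishing M ->
  finite_set (quot_edges H w) -> finite_set (quot_edges H w') ->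
  nuact (lpa_gap H w) m = m -> m <> 0 -> nuact (lpa_gap H w') n <> 0 -> w = w'.
Proof.
move=> sM HM fw fw' wm m0 wn; apply: contrapT => ww'; apply: wn.
have [a <-] := simple_gen sM n m0.
have [k ->] // := gap_corner a fw fw'.
rewrite -(gap_v_id wm) nuactA -nuscalerAl lpa_gap_v; case: eqP => [/esym//|_].
by rewrite scaler0 nuact0l.
Qed.

Lemma gap_iso H w M N (m : M) (n : N) : simple_module M -> simple_module N ->
  H `<=` vanishing M -> H `<=` vanishing N -> finite_set (quot_edges H w) ->
  m <> 0 -> n <> 0 -> nuact (lpa_gap H w) m = m -> nuact (lpa_gap H w) n = n ->
  module_iso M N.
Proof.
move=> sM sN HM HN fw m0 n0 wm wn.
apply: (simple_corner_iso sM sN m0 n0 wn wm) => a.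
have [k kP] := gap_corner a fw fw; rewrite !kP // (nuactZ_eq0 _ wm m0).
by rewrite (nuactZ_eq0 _ wn n0).
Qed.

End Vanishing.

(** * Finiteness of the hereditary saturated sets and of their breaking vertices *)

Section FiniteSets.
Variables (K : fieldType) (E : digraph).
Local Notation L := (leavitt_path_algebra K E).
Implicit Types (u v w : vertex E) (e f : edge E).
Implicit Types (a b : L) (M N : nonUnitalLmodType L) (H : set (vertex E)).
Local Notation "a ** b" := (numul a b) (at level 40, left associativity).

Lemma exists_simple_boundary H (y : stream E) v : hereditary H ->
  boundary_path H y -> step_src (y 0%N) = v ->
  exists (M : nonUnitalLmodType L) (m : M), [/\ simple_module M,
    H `<=` vanishing M, m <> 0, nuact (lpa_v K v) m = m &
    forall a, lpa_act H a (fun z : path_point E => if `[< z.1 = y >] then 1 else 0) =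
              (fun=> 0) -> nuact a m = 0].
Proof.
move=> hH yb yv; pose g (z : path_point E) : K := if `[< z.1 = y >] then 1 else 0.
have vg : lpa_act H (lpa_v K v) g = g.
  apply/funext => z; rewrite lpa_act_pi //= /g; case: asboolP => [zy|].
    by rewrite /on_path zy yv eqxx andbT; case: asboolP.
  by case: ifP.
have [|M [sM [m [m0 vm mI]]]] := simple_of_path_function hH vg.
  move/(congr1 (fun g => g (y, 0))); rewrite /g /=; case: asboolP => // _.
  by apply/eqP; exact: oner_neq0.
exists M, m; split=> //; apply: (simple_vanishing sM m0) => u a Hu.
apply: mI; apply/funext => z; rewrite lpa_actM // lpa_act_pi //=.
case: ifP => // /andP[/asboolP zb /eqP zu]; have [[+ _] _] := zb 0%N.
by rewrite zu.
Qed.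

(** By saturation, a regular vertex outside [H] has an edge ending outside [H]. Follow such edges
    forever or until a vertex that is not regular. *)
Lemma boundary_path_exists H v : saturated H -> ~ H v ->
  exists2 y : stream E, boundary_path H y & step_src (y 0%N) = v.
Proof.
move=> sH Hv.
have /choice[nxt nxtP] u : exists z : vertex E + edge E, ~ H u ->
    [/\ step_src z = u, step_ok H z & if z is inr e then ~ H (rng e) else True].
  have [Hu|Hu] := pselect (H u); first by exists (inl u).
  have [ru|nru] := pselect (regular u); last by exists (inl u).
  have /existsNP[w /not_implyP[[e eu <-] He]] := contra_not (sH u ru) Hu.
  by exists (inr e) => _; split=> //=; split=> //=; rewrite eu.
pose step z := match z with inl w => inl w | inr e => nxt (rng e) end.
pose y n := iter n step (nxt v).
have yP n : step_ok H (y n) /\ if y n is inr e then ~ H (rng e) else True.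
  elim: n => [|n [IH1 IH2]] /=; first by have [] := nxtP v Hv.
  rewrite /step; case yn: (y n) IH1 IH2 => [w|e] // _ He.
  by have [] := nxtP _ He.
exists y; last by have [] := nxtP v Hv.
move=> n; have [yo ye] := yP n; split=> //.
rewrite /y iterS -/(y n) /step; case: (y n) ye => [w|e] //= He.
by have [] := nxtP _ He.
Qed.

Hypothesis frt : finite_irreducible_representation_type L.

(** Each [H] is the common vanishing set of the modules [S i] that it annihilates: a boundary path
    from a vertex outside [H] gives such a module on which this vertex is nonzero. So there are at
    most as many [H] as sets of indices. *)
Lemma frt_hersat_finite :
  finite_set [set H : set (vertex E) | hereditary H /\ saturated H].
Proof.
have [n [S [sS allS]]] := frt.
pose g (B : {set 'I_n}) : set (vertex E) :=
  [set v | forall i, i \in B -> vanishing (S i) v].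
have : finite_set (g @` setT) by apply/finite_image/finite_finset.
apply: sub_finite_set => H [hH sH].
exists [set i : 'I_n | `[< H `<=` vanishing (S i) >]]%SET => //.
apply/seteqP; split=> [v gv|v Hv i]; last by rewrite inE => /asboolP; exact.
apply: contrapT => Hv; have [y yb yv] := boundary_path_exists sH Hv.
have [M [m [sM HM m0 vm _]]] := exists_simple_boundary hH yb yv.
have [i /vanishing_iso Mi] := allS M sM.
have vM : vanishing M v by rewrite Mi; apply: gv; rewrite inE; apply/asboolP; rewrite -Mi.
by apply: m0; rewrite -vm vM.
Qed.

Lemma frt_breaking_finite H : hereditary H -> finite_set (breaking H).
Proof.
move=> hH; apply: (frt_relation (r := fun M w => H `<=` vanishing M /\
  exists m : M, nuact (lpa_gap K H w) m <> 0) frt) => [w [iw Hw _ fw]|M N w|].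
(* The trivial path at the infinite emitter [w]. Its indicator is killed by each e e^*, since it
   does not start with an edge; so the gap acts on [m] as [w] does. *)
- pose y : stream E := fun=> inl w.
  have yb : boundary_path H y by move=> n; split=> //; split=> // -[].
  have [M [m [sM HM m0 vm mI]]] := exists_simple_boundary hH yb erefl.
  exists M => //; split=> //; exists m; rewrite nuactBl vm.
  rewrite nuact_suml big1 ?subr0 // => e _.
  apply: mI; apply/funext => z; rewrite lpa_actM // lpa_act_pi //=.
  case: ifP => // /andP[_ _]; rewrite lpa_act_pi //=; case: ifP => // _.
  case: asboolP => // /(congr1 (fun s => s 0%N)).
  by [].
- move=> MN [HM [m m0]]; split; first by rewrite -(vanishing_iso MN).
  have [f [bf fA]] := MN; exists (f m); rewrite -fA => fm0.
  by apply: m0; apply: (bij_inj bf); rewrite fm0 raddf0.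
- move=> M w w' sM [_ _ _ fw] [_ _ _ fw'] [HM [m m0]] [_ [m' m'0]].
  apply: (gap_orthogonal sM HM fw fw' _ m0 m'0).
  by rewrite nuactA lpa_gap_idem.
Qed.

End FiniteSets.

(** * Line points *)

Section QuotientGraph.
Variables (E : digraph) (H : hersat E).
Local Notation G := (quotient_graph H).
Implicit Types (p q : seq (edge E)).

Lemma sval_inj (T : Type) (P : T -> Prop) : injective (@sval T P).
Proof. by move=> [x Px] [y Py] /= xy; exact: eq_exist. Qed.

Lemma quot_walk (v w : vertex G) (p : seq (edge G)) :
  walk v p w -> walk (sval v) (map sval p) (sval w).
Proof.
elim: p v => [|e p IH] v /= => [/eqP->//|/andP[/eqP<- /IH]].
by rewrite eqxx.
Qed.

(** As [H] is hereditary, a walk ending outside [H] never enters [H]. *)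
Lemma quot_walk_lift (v w : vertex G) p : walk (sval v) p (sval w) ->
  exists2 p' : seq (edge G), walk v p' w & map sval p' = p.
Proof.
elim: p v => [|e p IH] v /=.
  by move=> /eqP/sval_inj->; exists [::] => /=.
move=> /andP[/eqP ev pw].
have He : ~ hersat_set H (rng e).
  by move/(hereditary_walk (hersat_hereditary (h:=H)) pw); exact: (svalP w).
have [p' p'w p'E] := IH (exist _ (rng e) He) pw.
exists ((exist _ e He : edge G) :: p'); last by rewrite /= p'E.
have rE : rng (exist _ e He : edge G) = exist _ (rng e) He by exact: sval_inj.
by apply/andP; split; [apply/eqP/sval_inj|rewrite rE].
Qed.

Lemma quot_cycle (e : edge G) (p : seq (edge G)) :
  is_cycle e p -> is_cycle (sval e) (map sval p).
Proof.
move=> [[ep pe] up]; split; last first.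
  rewrite -map_cons -map_comp (eq_map (g := sval \o (fun f : edge G => src f))) //.
  by rewrite map_comp (@map_inj_uniq (vertex G) (vertex E) sval) //; exact: sval_inj.
split; last first.
  by rewrite (last_map sval) -[RHS]/(sval (src e)) -pe.
rewrite /is_path path_map; apply: sub_path ep => f g /eqP fg /=.
by apply/eqP; move/(congr1 sval): fg.
Qed.

Lemma line_point_unique (u : vertex G) p w e f : line_point u ->
  walk (sval u) p w -> src e = w -> src f = w ->
  ~ hersat_set H (rng e) -> ~ hersat_set H (rng f) -> e = f.
Proof.
move=> lu uw ew fw He Hf.
have Hw : ~ hersat_set H w by rewrite -ew; exact: src_notin.
have [p' p'w _] := @quot_walk_lift u (exist _ w Hw) p uw.
have [|+ _] := lu (exist _ w Hw); first by apply/reachesP; exists p'.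
move=> /(_ (exist _ e He) (exist _ f Hf)) ef; apply: (congr1 sval (ef _ _));
  exact: sval_inj.
Qed.

Lemma not_line_point_bifurcation (u : vertex G) : acyclic E -> ~ line_point u ->
  exists p w e f, [/\ walk (sval u) p w, src e = w, src f = w, e <> f &
    ~ hersat_set H (rng e) /\ ~ hersat_set H (rng f)].
Proof.
move=> ac /existsNP[w /not_implyP[/reachesP[p uw] /not_andP[]]]; last first.
  by move=> /existsNP[e /existsNP[q /not_implyP[/quot_cycle/ac]]].
move=> /existsNP[e /existsNP[f /not_implyP[ew /not_implyP[fw ef]]]].
exists (map sval p), (sval w), (sval e), (sval f); split.
- exact: quot_walk.
- by rewrite -ew.
- by rewrite -fw.
- by move/sval_inj.
- by split; [exact: (svalP e)|exact: (svalP f)].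
Qed.

End QuotientGraph.

Section LinePoints.
Variables (E : digraph) (H : hersat E).
Hypothesis ac : acyclic E.
Hypothesis noline : line_points (quotient_graph H) = set0.
Variables (n : nat) (Q : 'I_n -> set (edge E)).
Hypothesis Q_src : forall i e f, Q i e -> Q i f -> src e = src f -> e = f.

Let bifurcation v : ~ hersat_set H v ->
  exists p w e f, [/\ walk v p w, src e = w, src f = w, e <> f &
    ~ hersat_set H (rng e) /\ ~ hersat_set H (rng f)].
Proof.
move=> Hv; apply: (@not_line_point_bifurcation _ _ (exist _ v Hv)) => // lv.
by have : line_points (quotient_graph H) (exist _ v Hv) by []; rewrite noline.
Qed.

(** By [Q_src], each [Q i] contains at most one of the two edges of a bifurcation, so the other edge
    leaves [Q i]. Treat the indices one after the other; the walk is kept nonempty so that it can be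
    iterated. *)
Lemma avoiding_walk (s : seq 'I_n) v : ~ hersat_set H v ->
  exists e p w, [/\ walk v (e :: p) w, ~ hersat_set H w &
    forall i, i \in s -> exists2 f, f \in e :: p & ~ Q i f].
Proof.
elim: s v => [|i s IH] v Hv.
  have [p [w [e [f [vw ew _ _ [He _]]]]]] := bifurcation Hv.
  have : walk v (rcons p e) (rng e).
    by rewrite -cats1; apply/walk_cat; exists w => //=; rewrite ew !eqxx.
  by case: p {vw} => [|g p] ve; [exists e, [::], (rng e)|exists g, (rcons p e), (rng e)].
have [p [w [e [f [vw ew fw ef [He Hf]]]]]] := bifurcation Hv.
have [g [gw Hg Qg]] : exists g, [/\ src g = w, ~ hersat_set H (rng g) & ~ Q i g].
  have [Qe|Qe] := pselect (Q i e); last by exists e.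
  exists f; split=> // Qf; apply: ef; apply: (Q_src Qe Qf); by rewrite ew fw.
have [e' [p' [w' [vw' Hw' sQ]]]] := IH _ Hg.
have vw'' : walk v (p ++ g :: e' :: p') w'.
  by apply/walk_cat; exists w => //; rewrite /= gw eqxx.
have key : forall j, j \in i :: s -> exists2 h, h \in p ++ g :: e' :: p' & ~ Q j h.
  move=> j; rewrite inE => /orP[/eqP->|/sQ[h hp Qh]].
    by exists g => //; rewrite mem_cat inE eqxx orbT.
  by exists h => //; rewrite mem_cat [in X in _ || X]inE hp !orbT.
case: p {vw} vw'' key => [|h p] vw'' key.
  by exists g, (e' :: p'), w'.
by exists h, (p ++ g :: e' :: p'), w'.
Qed.

Lemma avoiding_ray v : ~ hersat_set H v ->
  exists x : ray E, forall i k, exists2 j, (k <= j)%N & ~ Q i (x j).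
Proof.
move=> Hv.
have /choice[F FP] u : exists ep : edge E * seq (edge E), ~ hersat_set H u ->
    exists w, [/\ walk u (ep.1 :: ep.2) w, ~ hersat_set H w &
    forall i, exists2 f, f \in ep.1 :: ep.2 & ~ Q i f].
  have [Hu|Hu] := pselect (hersat_set H u).
    by have [_ [_ [e _]]] := bifurcation Hv; exists (e, [::]).
  have [e [p [w [uw Hw pQ]]]] := avoiding_walk (enum 'I_n) Hu.
  by exists (e, p) => _; exists w; split=> // i; apply: pQ; rewrite mem_enum.
(* A state is the current edge with the remaining edges of the current avoiding walk; when none
   remain, [F] starts a new one. *)
pose next (st : edge E * seq (edge E)) :=
  if st.2 is f :: r then (f, r) else F (rng st.1).
pose st k := iter k next (F v).
have stP k : exists2 w, walk (rng (st k).1) (st k).2 w & ~ hersat_set H w.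
  elim: k => [|k [w kw Hw]].
    by have [w [/= /andP[_ vw] Hw _]] := FP v Hv; exists w.
  rewrite /st iterS -/(st k) /next; case: (st k) kw => e [|f r] /=.
    move=> /eqP ew; rewrite -ew in Hw.
    by have [w' [/= /andP[_ vw] Hw' _]] := FP _ Hw; exists w'.
  by move=> /andP[_ fw]; exists w.
have st_path k : rng (st k).1 = src (st k.+1).1.
  have [w kw Hw] := stP k; rewrite /st iterS -/(st k) /next.
  case: (st k) kw => e [|f r] /=; last by move=> /andP[/eqP].
  move=> /eqP ew; rewrite -ew in Hw.
  by have [w' [/= /andP[/eqP]]] := FP _ Hw.
(* After every index the current walk ends, and [visit] shows that the following one is traversed
   completely, including its edge outside [Q i]. *)
have run k : exists2 j, (k <= j)%N & (st j).2 = [::].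
  move: {2}(st k).2 (erefl (st k).2) => r; elim: r k => [|f r IH] k kr.
    by exists k.
  have [|j kj jr] := IH k.+1; last by exists j => //; exact: ltnW.
  by rewrite /st iterS -/(st k) /next kr.
have visit k r : (st k).2 = r -> forall f, f \in (st k).1 :: r ->
    exists2 j, (k <= j)%N & (st j).1 = f.
  elim: r k => [|g r IH] k kr f.
    by rewrite inE => /eqP->; exists k.
  rewrite inE => /orP[/eqP->|fr]; first by exists k.
  have kE : st k.+1 = (g, r) by rewrite /st iterS -/(st k) /next kr.
  have [||j kj jf] := IH k.+1 _ f; rewrite ?kE //.
  by exists j => //; exact: ltnW.
exists (exist _ (fun k => (st k).1) st_path) => i k /=.
have [j kj jr] := run k; have [w jw Hw] := stP j.
rewrite jr /= in jw; rewrite -(eqP jw) in Hw.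
have [w' [_ _ /(_ i)[f fF Qf]]] := FP _ Hw.
have jE : st j.+1 = F (rng (st j).1) by rewrite /st iterS -/(st j) /next jr.
have [|j' jj' jf] := visit j.+1 _ erefl f; first by rewrite jE.
by exists j'; rewrite ?jf //; apply: leq_trans (ltnW jj').
Qed.

End LinePoints.

Section Chain.
Variables (K : fieldType) (E : digraph).
Local Notation L := (leavitt_path_algebra K E).
Hypothesis frt : finite_irreducible_representation_type L.

Lemma ray_src_inj (x : ray E) j k : acyclic E -> src (x j) = src (x k) -> x j = x k.
Proof.
move=> ac; wlog jk : j k / (j <= k)%N.
  by move=> wl; case: (leqP j k) => [|/ltnW] jk; [exact: wl|move/esym/wl=> ->].
rewrite leq_eqVlt in jk; case/orP: jk => [/eqP->//|jk] sjk; exfalso.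
have := walk_segment x j (k - j); rewrite subnKC ?(ltnW jk) // -sjk.
case: (k - j)%N (subn_gt0 j k) => [|l _]; first by rewrite jk.
by rewrite /=; apply/negP/(acyclic_walk _ _ _ ac).
Qed.

Lemma frt_line_points (H : hersat E) :
  line_points (quotient_graph H) = set0 -> hersat_set H = setT.
Proof.
move=> noline; apply/seteqP; split=> // v _; apply: contrapT => Hv.
have ac := frt_acyclic frt; have [n [S [sS allS]]] := frt.
pose on i (x : ray E) := exists m : S i, m <> 0 /\ on_ray x m.
(* One infinite path is chosen for each simple module that has any, and the empty set otherwise. One
   path suffices, because by [on_ray_meet] every other one realized in the same module eventually
   runs inside it. *)
pose Q i : set (edge E) :=
  if pselect (exists x, on i x) is left h then range (ray_edge (sval (cid h))) else set0.
have Q_src i e f : Q i e -> Q i f -> src e = src f -> e = f.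
  rewrite /Q; case: pselect => // h [j _ <-] [k _ <-]; exact: ray_src_inj.
have [x xQ] := avoiding_ray ac noline Q_src Hv.
have one0 : (1 : K) <> 0 by apply/eqP; exact: oner_neq0.
have [M [m [sM m0 xm _]]] := exists_simple_on_ray (phi := fun=> 1) (i0 := 0) x one0.
have [i [f [bf fA]]] := allS M sM.
have fm0 : f m <> 0 by move=> fm0; apply: m0; apply: (bij_inj bf); rewrite raddf0.
have xfm : on_ray x (f m) by move=> k; rewrite -fA xm.
have ex : exists x, on i x by exists x, (f m).
have := xQ i; rewrite /Q; case: pselect => // h; case: cid => /= y [n0 [n00 yn]].
have [k0 k0P] := on_ray_meet (sS i) n00 fm0 yn xfm.
by move=> /(_ k0)[j /k0P[l ->]]; apply; exists l.
Qed.

End Chain.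

(** * The ascending chain built from line points *)

Section Closure.
Variable E : digraph.

Lemma hs_closure_hereditary (X : set (vertex E)) : hereditary (hs_closure X).
Proof. by move=> v w Xv vw Y YX; have [[hY _] _] := YX; apply: hY vw; exact: Xv. Qed.

Lemma hs_closure_saturated (X : set (vertex E)) : saturated (hs_closure X).
Proof.
move=> v rv sv Y YX; have [[_ sY] _] := YX; apply: sY rv _.
by move=> w /sv; apply.
Qed.

Lemma sub_hs_closure (X : set (vertex E)) : X `<=` hs_closure X.
Proof. exact: sub_gen_smallest. Qed.

End Closure.

Section LineChain.
Variable E : digraph.

Section Next.
Variable H : hersat E.
Local Notation G := (quotient_graph H).

Definition line_next : set (vertex E) :=
  hersat_set H `|` sval @` hs_closure (line_points G).

Lemma line_next_hereditary : hereditary line_next.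
Proof.
apply/hereditary_edgeP => e [He|[u cu ue]].
  by left; apply: (proj1 (hereditary_edgeP _) (hersat_hereditary (h:=H))).
have [He|He] := pselect (hersat_set H (rng e)); first by left.
right; exists (exist _ (rng e) He) => //.
apply: (hs_closure_hereditary cu); apply/reachesP; exists [:: exist _ e He].
by apply/andP; split; apply/eqP/sval_inj.
Qed.

(** A vertex outside [H] that is regular in E stays regular in the quotient graph: saturation of [H]
    leaves it at least one edge. *)
Lemma line_next_saturated : saturated line_next.
Proof.
move=> v [fv nv] sv; have [Hv|Hv] := pselect (hersat_set H v); first by left.
right; exists (exist _ v Hv) => //; apply: hs_closure_saturated; last first.
  move=> _ [e ev <-]; have [|He|[u cu ue]] := sv (rng (sval e)).
  - by exists (sval e) => //; move/(congr1 sval): ev.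
  - by have := svalP e.
  - by rewrite (_ : rng e = u) //; apply/sval_inj.
split.
  apply: (@sub_finite_set _ _ (@sval _ _ @^-1` out_edges v)).
    by move=> e /(congr1 sval).
  by apply: finite_preimage fv => e f _ _; exact: sval_inj.
have /existsNP[_ /not_implyP[[e ev <-] He]] :=
  contra_not (hersat_saturated (h:=H) (conj fv nv)) Hv.
by exists (exist _ e He); apply/sval_inj.
Qed.

Definition hersat_next := HerSat line_next_hereditary line_next_saturated.

Lemma hersat_nextD :
  hersat_next `\` H = sval @` hs_closure (line_points G).
Proof.
apply/seteqP; split=> [v [[]//]|_ [u cu <-]].
by split; [right; exists u|exact: (svalP u)].
Qed.

End Next.

Fixpoint line_chain n : hersat E :=
  if n is n'.+1 then hersat_next (line_chain n') else hersat0 E.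

Section AdmChain.
Variable H : nat -> hersat E.
Hypothesis H_step : forall j,
  H j.+1 `\` H j = sval @` hs_closure (line_points (quotient_graph (H j))).
Hypothesis H_sub : forall j, H j `<=` H j.+1.

(* A breaking vertex of H_j all of whose edges outside H_j end in H_(j+1)
   is regular in the quotient graph, hence lies in H_(j+1). *)
Lemma breaking_next j :
  breaking (H j) `<=` H j.+1 `|` (breaking (H j) `&` breaking (H j.+1)).
Proof.
move=> w [iw Hw [e [we He]] fw].
have [Hw1|Hw1] := pselect (hersat_set (H j.+1) w); [by left|right].
split; first by split=> //; exists e.
have sub : quot_edges (H j.+1) w `<=` quot_edges (H j) w.
  by move=> f [wf Hf]; split=> // /H_sub.
split=> //; last exact: sub_finite_set fw.
apply: contrapT => none; apply: Hw1.
pose u : vertex (quotient_graph (H j)) := exist _ w Hw.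
suff : (H j.+1 `\` H j) w by case.
rewrite H_step; exists u => //; apply: hs_closure_saturated.
  split; last by exists (exist _ e He); apply/sval_inj.
  apply: (@sub_finite_set _ _ (@sval _ _ @^-1` quot_edges (H j) w)).
    by move=> f /(congr1 sval) /= wf; split=> //; exact: (svalP f).
  by apply: finite_preimage fw => f g _ _; exact: sval_inj.
move=> _ [f /(congr1 sval) /= wf <-].
have : (H j.+1 `\` H j) (rng (sval f)).
  split; last exact: (svalP f).
  by apply: contrapT => Hf; apply: none; exists (sval f).
rewrite H_step => -[t ct tf]; move: ct.
by have -> : t = rng f by exact: sval_inj.
Qed.

(** After the first step, the chain alternately enlarges the set of breaking vertices over a fixed
    [H j] and passes to [H j.+1]; the latter steps rest on [breaking_next]. *)
Lemma adm_chain_le k : (adm_chain H k <= adm_chain H k.+1)%O.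
Proof.
apply/asboolP; case: k => [|k] /=; first by split=> //=; exact: H_sub.
case: k => [|k] /=; first by split=> //=.
rewrite uphalfE /=; case: (boolP (odd k)) => /= ok; rewrite /adm_le /=.
  by rewrite uphalf_half ok; split=> // v []; right.
rewrite uphalf_half (negPf ok) add0n; split=> /=; first exact: H_sub.
exact: breaking_next.
Qed.

End AdmChain.

(** The last term dominates a finite ascending chain, and the pair over E^0 lies above every
    admissible pair. *)
Lemma adm_chain_sup (H : nat -> hersat E) n :
  (forall k, (k < n)%N -> (adm_chain H k <= adm_chain H k.+1)%O) ->
  supremums [set adm_chain H k | k in `I_n.+1] (adm0 (hersatT E)) <->
  hersat_set (adm_hersat (adm_chain H n)) = setT.
Proof.
move=> Hle; have le_n k : (k <= n)%N -> (adm_chain H k <= adm_chain H n)%O.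
  move=> kn; rewrite -(subKn kn); elim: (n - k)%N => [|i IH]; first by rewrite subn0.
  have [ni|ni] := leqP n i.
    by rewrite (eqP (_ : n - i.+1 == n - i)%N) //; apply/eqP; lia.
  by apply: le_trans IH; rewrite -[X in (_ <= adm_chain H X)%O](subnSK ni); apply: Hle; lia.
split=> [[_ sup]|HT].
  have /asboolP[/= TH _] : (adm0 (hersatT E) <= adm_chain H n)%O.
    by apply: sup => _ [k /= kn <-]; apply: le_n.
  by apply/seteqP; split.
split=> [_ [k _ <-]|P ubP].
  by apply/asboolP; split=> // v _; left.
have /asboolP[/= HP _] : (adm_chain H n <= P)%O by apply: ubP; exists n => /=.
by apply/asboolP; split=> //=; rewrite -HT.
Qed.

End LineChain.

Lemma frt_chain (K : fieldType) (E : digraph) :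
  finite_irreducible_representation_type (leavitt_path_algebra K E) ->
  exists (H : nat -> hersat E) (n : nat),
        [/\ H 0%N = hersat0 E,
            forall j, H j.+1 `\` H j =
              sval @` hs_closure (line_points (quotient_graph (H j))),
            forall k, (k < n)%N -> (adm_chain H k <= adm_chain H k.+1)%O &
            supremums [set adm_chain H k | k in `I_n.+1] (adm0 (hersatT E))].
Proof.
move=> frt; pose H := @line_chain E.
have H_step j : H j.+1 `\` H j = sval @` hs_closure (line_points (quotient_graph (H j))).
  exact: hersat_nextD.
have H_sub j : H j `<=` H j.+1 by move=> v; left.
have H_homo i j : (i <= j)%N -> H i `<=` H j.
  move=> ij; rewrite -(subnKC ij); elim: (j - i)%N => [|k IH]; first by rewrite addn0.
  by rewrite addnS; apply: subset_trans IH (H_sub _).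
(* Finitely many hereditary saturated sets force a repetition. The chain is then constant from [i]
   to [j], so the quotient by [H i] has no line points. *)
have [i [j [ij HE]]] : exists i j, (i < j)%N /\ hersat_set (H i) = hersat_set (H j).
  apply: contrapT => inj; apply: infinite_nat.
  have := frt_hersat_finite frt.
  move=> /(@finite_preimage _ _ _ (fun j => hersat_set (H j))) fin.
  have {}fin := fin _; apply: sub_finite_set (fin _) => [j _|a b _ _ ab].
    by split; [exact: hersat_hereditary|exact: hersat_saturated].
  by have [ab'|ba|//] := ltngtP a b; exfalso; apply: inj; [exists a, b|exists b, a].
have HiT : hersat_set (H i) = setT.
  apply: (frt_line_points frt); apply/seteqP; split=> // v lv.
  have : (H i.+1 `\` H i) (sval v).
    by rewrite H_step; exists v => //; exact: sub_hs_closure.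
  by move=> [/(H_homo _ _ ij)]; rewrite -HE.
have le_chain := adm_chain_le H_step H_sub.
(* For positive [i] this is the position of the pair [admB (H i)] in the chain. *)
exists H, i.*2; split=> //; apply/adm_chain_sup => //.
case: (i) HiT => [|k] //; rewrite doubleS /= odd_double /=.
by rewrite doubleK.
Qed.

(** * Classification of the simple modules *)

(** One representative is chosen for each tag that some simple module carries. *)
Lemma frt_of_tags (R : nonUnitalRingType) (T : eqType) (A : set T)
    (tag : nonUnitalLmodType R -> T -> Prop) : finite_set A ->
  (forall M, simple_module M -> exists2 t, A t & tag M t) ->
  (forall M N t, simple_module M -> simple_module N -> tag M t -> tag N t ->
     module_iso M N) ->
  finite_irreducible_representation_type R.
Proof.
move=> fA ex iso.
pose B := [set t | A t /\ exists2 M, simple_module M & tag M t].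
have /finite_seqP[s sE] : finite_set B by apply: sub_finite_set fA => t [].
have sP (i : 'I_(size s)) : exists M, simple_module M /\ tag M (tnth (in_tuple s) i).
  have : B (tnth (in_tuple s) i) by rewrite sE /= mem_tnth.
  by move=> [_ [M sM tM]]; exists M.
have [S SP] := choice sP.
exists (size s), S; split=> [i|M sM]; first by have [] := SP i.
have [t At tM] := ex M sM.
have : B t by split=> //; exists M.
rewrite sE /= => /(tnthP (in_tuple s))[i ti]; exists i.
have [sS tS] := SP i; apply: (iso _ _ t) => //; by rewrite ti.
Qed.

Section LineModule.
Variables (K : fieldType) (E : digraph) (H : hersat E).
Local Notation L := (leavitt_path_algebra K E).
Local Notation G := (quotient_graph H).
Hypothesis ac : acyclic E.
Implicit Types (v w : vertex E) (e f : edge E) (p q r : seq (edge E)).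
Implicit Types (a b : L) (M N : nonUnitalLmodType L).
Local Notation "a ** b" := (numul a b) (at level 40, left associativity).

Definition gapless M :=
  forall w (m : M), breaking H w -> nuact (lpa_gap K H w) m = 0.

Lemma vanishing_eg M e (m : M) : vanishing M (rng e) ->
  nuact (lpa_e K e ** lpa_g K e) m = 0.
Proof. by move=> ve; rewrite -nuactA vanishing_e. Qed.

(* Relation (4) modulo H, which gaplessness extends to the breaking vertices. *)
Lemma gapless_sum M v (m : M) : hersat_set H `<=` vanishing M -> gapless M ->
  ~ hersat_set H v -> quot_edges H v !=set0 -> finite_set (quot_edges H v) ->
  nuact (lpa_v K v) m =
    \sum_(e <- fset_set (quot_edges H v)) nuact (lpa_e K e ** lpa_g K e) m.
Proof.
move=> HM gM Hv qv fv; have [fo|io] := pselect (finite_set (out_edges v)); last first.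
  have /(gM _ m) : breaking H v by split.
  by rewrite nuactBl nuact_suml => /eqP; rewrite subr_eq0 => /eqP.
have rv : regular v by split=> //; case: qv => e [ve _]; exists e.
rewrite lpa_vsum // nuact_suml (bigID (fun e => `[< hersat_set H (rng e) >])) /=.
rewrite big1 ?add0r => [|e /asboolP He]; last exact/vanishing_eg/HM.
rewrite -big_filter; apply: perm_big; apply: uniq_perm.
- by rewrite filter_uniq // fset_uniq.
- exact: fset_uniq.
- move=> e; rewrite mem_filter !in_fset_set //; apply/andP/idP.
    by move=> [/asboolPn He /set_mem ve]; apply/mem_set; split.
  by move=> /set_mem[ve He]; split; [exact/asboolPn|exact/mem_set].
Qed.

Lemma quot_saturated M : hersat_set H `<=` vanishing M -> gapless M ->
  saturated [set x : vertex G | vanishing M (sval x)].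
Proof.
move=> HM gM x [fx [e ex]] sx m.
have sub : quot_edges H (sval x) `<=` sval @` out_edges x.
  move=> f [fe Hf]; exists (exist _ f Hf) => //; exact: sval_inj.
have fq : finite_set (quot_edges H (sval x)).
  by apply: sub_finite_set sub _; apply: finite_image.
rewrite (gapless_sum m HM gM (svalP x)) //; last first.
  exists (sval e); split; first by move/(congr1 sval): ex.
  exact: (svalP e).
rewrite big_seq big1 // => f /fset_set_mem/sub[g gx <-].
by apply: vanishing_eg; apply: (sx (rng g)); exists g.
Qed.

Lemma quot_hereditary M :
  hereditary [set x : vertex G | vanishing M (sval x)].
Proof.
apply/hereditary_edgeP => e /= se.
exact: (proj1 (hereditary_edgeP _) (vanishing_hereditary (M:=M)) (sval e)).
Qed.

Section LinePoint.
Variable u : vertex G.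
Hypothesis lu : line_point u.

(** Below a line point the next edge outside [H] is forced, and acyclicity prevents one walk from
    continuing after the other has reached [w]. *)
Lemma line_walk_unique r v p q w : walk (sval u) r v -> ~ hersat_set H w ->
  walk v p w -> walk v q w -> p = q.
Proof.
move=> + Hw; elim: p v r q => [|e p IH] v r [|f q] //= uv.
- move=> /eqP-> qw; have := acyclic_walk w f q ac.
  by rewrite /= qw.
- move=> pw /eqP vw; have := acyclic_walk w e p ac.
  by rewrite /= -{1}vw pw.
- move=> /andP[/eqP ev pw] /andP[/eqP fv qw].
  have He : ~ hersat_set H (rng e).
    by move/(hereditary_walk (hersat_hereditary (h:=H)) pw).
  have Hf : ~ hersat_set H (rng f).
    by move/(hereditary_walk (hersat_hereditary (h:=H)) qw).
  have ef := line_point_unique lu uv ev fv He Hf; subst f.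
  congr (_ :: _); apply: (IH (rng e) (r ++ [:: e])) => //.
  by apply/walk_cat; exists v; rewrite //= ev !eqxx.
Qed.

Lemma line_edge_act M r v e (m : M) : hersat_set H `<=` vanishing M -> gapless M ->
  walk (sval u) r v -> src e = v -> ~ hersat_set H (rng e) ->
  nuact (lpa_v K v) m = nuact (lpa_e K e ** lpa_g K e) m.
Proof.
move=> HM gM uv ev He.
have qe : quot_edges H v = [set e].
  apply/seteqP; split=> [f [fv Hf]|_ ->]; last by [].
  exact: (line_point_unique lu uv fv ev Hf He).
rewrite (gapless_sum m HM gM) ?qe ?fset_set1 ?big_seq_fset1 //.
  by rewrite -ev; exact: src_notin.
by exists e.
Qed.

Lemma line_path_act M r v p w (m : M) : hersat_set H `<=` vanishing M -> gapless M ->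
  walk (sval u) r v -> walk v p w -> ~ hersat_set H w ->
  nuact (lpa_v K v) m = m ->
  nuact (lpa_path K p w) (nuact (lpa_ghost K p w) m) = m.
Proof.
move=> HM gM uv + Hw; elim: p r v m uv => [|e p IH] r v m uv /=.
  by move=> /eqP<- vm; rewrite !vm.
move=> /andP[/eqP ev pw] vm.
have He : ~ hersat_set H (rng e).
  by move/(hereditary_walk (hersat_hereditary (h:=H)) pw).
rewrite -!nuactA (IH (r ++ [:: e]) (rng e)) //.
- by rewrite nuactA -(line_edge_act m HM gM uv).
- by apply/walk_cat; exists v; rewrite //= ev !eqxx.
- by rewrite nuactA lpa_gK.
Qed.

(** Compressed to [u], a monomial p q^* survives only if both paths run from [u] to the same vertex
    outside [H]. Then p = q, and p p^* acts as [u] by the relations along the line. Again the scalar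
    precedes the module. *)
Lemma line_corner a : exists k : K, forall M (m : M),
  hersat_set H `<=` vanishing M -> gapless M ->
  nuact (lpa_v K (sval u)) m = m ->
  nuact (lpa_v K (sval u)) (nuact a m) = nuact (k *: lpa_v K (sval u)) m.
Proof.
elim: (lpa_spannedP a) => [|b c _ [k kP] _ [l lP]|k w p q].
- by exists 0 => M m _ _ _; rewrite scale0r !nuact0l nuact0r.
- exists (k + l) => M m HM gM um.
  by rewrite nuactDl nuactDr kP // lP // scalerDl nuactDl.
have [Hw|Hw] := pselect (hersat_set H w).
  exists 0 => M m HM gM um; rewrite scale0r nuact0l nuscalerAr -nuactA.
  have := lpa_pathv K p w w; rewrite eqxx => <-.
  by rewrite -nuactA (HM w Hw) !nuact0r.
have [pw|pw] := boolP (walk (sval u) p w); last first.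
  exists 0 => M m HM gM um; rewrite scale0r nuact0l nuscalerAr nuactA numulA.
  by rewrite lpa_vpath (negPf pw) numul0r nuact0l.
have [qw|qw] := boolP (walk (sval u) q w); last first.
  exists 0 => M m HM gM um; rewrite scale0r nuact0l -um [nuact (k *: _) _]nuactA.
  by rewrite -nuscalerAl -numulA lpa_ghostv (negPf qw) numulr0 scaler0 nuact0l nuact0r.
have uu : walk (sval u) [::] (sval u) by rewrite /=.
exists k => M m HM gM um; rewrite (line_walk_unique uu Hw qw pw).
by rewrite nuactA -nuscalerAr nuscalerAl -!nuactA (line_path_act HM gM uu pw Hw um).
Qed.

Lemma line_iso M N : simple_module M -> simple_module N ->
  hersat_set H `<=` vanishing M -> hersat_set H `<=` vanishing N ->
  gapless M -> gapless N ->
  ~ vanishing M (sval u) -> ~ vanishing N (sval u) -> module_iso M N.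
Proof.
move=> sM sN HM HN gM gN /existsNP[m m0] /existsNP[n n0].
set v := lpa_v K (sval u) in m0 n0.
have um : nuact v (nuact v m) = nuact v m by rewrite nuactA lpa_vid.
have un : nuact v (nuact v n) = nuact v n by rewrite nuactA lpa_vid.
apply: (simple_corner_iso sM sN m0 n0 un um) => a.
have [k kP] := line_corner a; rewrite !kP // (nuactZ_eq0 _ um m0).
by rewrite (nuactZ_eq0 _ un n0).
Qed.

End LinePoint.
End LineModule.

Lemma adm_chain_hersat (E : digraph) (H : nat -> hersat E) k :
  adm_hersat (adm_chain H k) = H (uphalf k).
Proof.
case: k => [|[|k]] //=; rewrite uphalf_half.
by case: (odd k).
Qed.

Theorem theorem5p2 (K : fieldType) (E : digraph) :
  finite_irreducible_representation_type (leavitt_path_algebra K E) <->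
  [/\ acyclic E,
      finite_set [set H : set (vertex E) | hereditary H /\ saturated H] /\
      (forall H : set (vertex E),
         hereditary H -> saturated H -> finite_set (breaking H)) &
      exists (H : nat -> hersat E) (n : nat),
        [/\ H 0%N = hersat0 E,
            forall j, H j.+1 `\` H j =
              sval @` hs_closure (line_points (quotient_graph (H j))),
            forall k, (k < n)%N -> (adm_chain H k <= adm_chain H k.+1)%O &
            supremums [set adm_chain H k | k in `I_n.+1] (adm0 (hersatT E))]].
Proof.
split=> [frt|[ac [fH fB] [H [n [H0 H_step Hle Hsup]]]]].
  split; [exact: frt_acyclic frt| |exact: frt_chain frt].
  split; first exact: frt_hersat_finite frt.
  by move=> H hH _; exact: frt_breaking_finite frt _ hH.
have HJ : hersat_set (H (uphalf n)) = setT.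
  by rewrite -adm_chain_hersat; apply/adm_chain_sup.
set J := uphalf n in HJ.
(* The invariant of a simple module: the last stage of the chain annihilating it, its vanishing set,
   and the breaking vertex whose gap is nonzero, if any. The vanishing set ensures that a line point
   acting nontrivially on one module does so on the other. *)
pose tag (M : nonUnitalLmodType (leavitt_path_algebra K E))
    (t : nat * set (vertex E) * option (vertex E)) :=
  [/\ vanishing M = t.1.2, hersat_set (H t.1.1) `<=` t.1.2,
      ~ hersat_set (H t.1.1.+1) `<=` t.1.2 &
      if t.2 is Some w then breaking (H t.1.1) w /\
        exists m : M, nuact (lpa_gap K (H t.1.1) w) m <> 0
      else gapless (H t.1.1) M].
pose A := [set j | (j < J)%N] `*` [set H : set (vertex E) | hereditary H /\ saturated H]
  `*` (None |` Some @` \bigcup_(j in [set j | (j < J)%N]) breaking (H j)).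
have fJ : finite_set [set j | (j < J)%N] by exact: finite_II.
apply: (@frt_of_tags _ _ A tag) => [|M sM|M N [[j Z] o] sM sN].
- apply: finite_setX; first exact: finite_setX.
  rewrite finite_setU; split; first exact: finite_set1.
  apply/finite_image/bigcup_finite => // j _.
  by apply: fB; [exact: hersat_hereditary|exact: hersat_saturated].
(* Minimality is applied to the first stage not annihilating [M]. It exists since [H J] is
   everything, and it is a successor since [H 0] is empty; its predecessor is the required [j]. *)
- pose P i := `[< ~ hersat_set (H i) `<=` vanishing M >].
  have PJ : P J.
    apply/asboolP; rewrite HJ => TM; apply: (simple_vanishingT sM).
    by apply/seteqP; split.
  case: (ex_minnP (ex_intro P J PJ)) => -[|j] /asboolP Pj minj.
    by case: Pj; rewrite H0.
  have jJ : (j < J)%N by exact: minj.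
  have HjM : hersat_set (H j) `<=` vanishing M.
    by apply: contrapT => /asboolP/minj; rewrite ltnn.
  have [[w [bw gw]]|ng] := pselect (exists w, breaking (H j) w /\
      exists m : M, nuact (lpa_gap K (H j) w) m <> 0).
    exists (j, vanishing M, Some w); last by split.
    split; first by split=> //; split; [exact: vanishing_hereditary|exact: vanishing_saturated].
    by right; exists w => //; exists j.
  exists (j, vanishing M, None).
    split; last by left.
    by split=> //; split; [exact: vanishing_hereditary|exact: vanishing_saturated].
  split=> //= w m bw; apply: contrapT => wm; apply: ng; exists w; split=> //.
  by exists m.
- move=> [/= <- HM HM' oM] [/= NM _ _ oN].
  have HN : hersat_set (H j) `<=` vanishing N by rewrite NM.
  case: o oM oN => [w [[_ _ _ fw] [m m0]] [_ [n' n0]]|gM gN].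
    apply: (gap_iso sM sN HM HN fw m0 n0); by rewrite nuactA lpa_gap_idem.
  (* If all line points killed [M], so would their hereditary saturated closure, since the vanishing
     set is hereditary and saturated in the quotient graph. Then [H j.+1] would annihilate [M]. *)
  have [u lu uM] : exists2 u : vertex (quotient_graph (H j)),
      line_point u & ~ vanishing M (sval u).
    apply: contrapT => nu; apply: HM' => v Hv.
    have [Hjv|Hjv] := pselect (hersat_set (H j) v); first exact: HM.
    have : (H j.+1 `\` H j) v by [].
    rewrite H_step => -[x cx <-].
    apply: (cx [set x | vanishing M (sval x)]); split.
      by split; [exact: quot_hereditary|exact: quot_saturated].
    by move=> y ly /=; apply: contrapT => yM; apply: nu; exists y.
  by apply: (line_iso ac lu sM sN HM HN gM gN uM); rewrite NM.
Qed.
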